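(* Let $f\in C^2([0,\infty),\mathbb{R})$ and let $(a,k,\omega)\in(0,\infty)\times\mathbb{R}^2$ be such that $\omega^2=k^2+f(a^2)$. Consider the plane-wave solution $u(x,t)=a e^{ikx+i\omega t}$ to the complex Klein-Gordon equation $u_{tt}-u_{xx}+f(|u|^2)u=0$, $x,t\in\mathbb{R}$. (1) If $f(a^2)>0$, then the plane wave is spectrally stable if $f'(a^2)>0$ and spectrally unstable if $-2f(a^2)<a^2f'(a^2)<0$. (2) If $f(a^2)<0$, then the plane wave is spectrally stable if $a^2f'(a^2)>-2f(a^2)$ and spectrally unstable if $0<a^2f'(a^2)<-2f(a^2)$.
   Context: Let $c\in\mathbb{R}\setminus\{\pm1\}$ be the speed of a co-moving frame. Writing $u(x,t)=a e^{ikx+i\omega t}(1+z(x-ct,t))$ and linearizing the resulting equation in $Z=(\mathrm{Re}\,z,\mathrm{Im}\,z)^\top$ about $0$ gives $Z_{tt}+\mathcal{J}_c(\partial_y)Z_t+\mathcal{H}_c(\partial_y)Z=0$ with $$\mathcal{J}_c(D)=\begin{pmatrix}-2cD&-2\omega\\2\omega&-2cD\end{pmatrix},\qquad \mathcal{H}_c(D)=\begin{pmatrix}-(1-c^2)D^2+2a^2f'(a^2)&2(c\omega+k)D\\-2(c\omega+k)D&-(1-c^2)D^2\end{pmatrix}.$$ The spectrum associated with the plane wave is $$\sigma_c=\{\lambda\in\mathbb{C}:\mathcal{P}_c(\lambda)\text{ is not invertible}\},\qquad \mathcal{P}_c(\lambda)=\lambda^2I_2+\lambda\mathcal{J}_c(\partial_y)+\mathcal{H}_c(\partial_y),$$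 where $\mathcal{P}_c(\lambda)$ is viewed as an operator on $L^2(\mathbb{R},\mathbb{C}^2)$ with domain $H^2(\mathbb{R},\mathbb{C}^2)$. Equivalently, $\lambda\in\sigma_c$ if and only if there is $\ell\in\mathbb{R}$ with $\det\big(\lambda^2I_2+\lambda\mathcal{J}_c(i\ell)+\mathcal{H}_c(i\ell)\big)=0$. The plane wave is called spectrally stable if $\sigma_c\subset i\mathbb{R}$, and spectrally unstable if it is not spectrally stable; this property does not depend on the choice of $c$. *)

(* Defs.v *)
From HB Require Import structures.
From mathcomp Require Import all_boot all_order all_algebra.
From mathcomp Require Import complex.
From mathcomp Require Import all_classical all_reals all_analysis.

Set Implicit Arguments.
Unset Strict Implicit.
Unset Printing Implicit Defensive.

Import Order.TTheory GRing.Theory Num.Theory.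
Import numFieldNormedType.Exports.

Local Open Scope classical_set_scope.
Local Open Scope ring_scope.
Local Open Scope complex_scope.

(* Only the values of f on [0, +oo) matter; the derivative at 0 is one-sided. *)
Definition has_derivative_nonneg (R : realType) (f f1 : R -> R) : Prop :=
  forall x : R, 0 <= x ->
    (fun y : R => (f y - f x) / (y - x)) @ within `[0, +oo[ x^' --> f1 x.

Definition C2_nonneg (R : realType) (f : R -> R) : Prop :=
  exists f1 f2 : R -> R,
    [/\ has_derivative_nonneg f f1, has_derivative_nonneg f1 f2 &
        {within `[0, +oo[, continuous f2}].

Section SobolevSpaces.
Context {R : realType}.
Local Notation mu := (@lebesgue_measure R).

Definition L2_complex (u : R -> R[i]) : Prop :=
  (fun y => complex.Re (u y)) \in Lfun mu 2%:E /\
  (fun y => complex.Im (u y)) \in Lfun mu 2%:E.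

Definition complex_integral (A : set R) (u : R -> R[i]) : R[i] :=
  (\int[mu]_(t in A) complex.Re (u t)) +i* (\int[mu]_(t in A) complex.Im (u t)).

(* u belongs to H^1(R, C) with derivative v: elements of L^2 are functions up
   to almost everywhere equality, and H^1 consists of those u in L^2 which have
   a locally absolutely continuous representative with derivative in L^2. *)
Definition H1_derivative_complex (u v : R -> R[i]) : Prop :=
  [/\ L2_complex u, L2_complex v &
      exists2 u' : R -> R[i], {ae mu, forall y, u y = u' y} &
        forall x y : R, x <= y ->
          u' y - u' x = complex_integral `[x, y] v].

Definition L2 (Z : R -> 'cV[R[i]]_2) : Prop :=
  forall i : 'I_2, L2_complex (fun y => Z y i 0).

Definition L2_norm (Z : R -> 'cV[R[i]]_2) : \bar R :=
  Lnorm mu 2%:E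
    (fun y => (Num.sqrt (\sum_(i < 2) (complex.Re (Z y i 0) ^+ 2 +
                                       complex.Im (Z y i 0) ^+ 2)))%:E).

Definition H1_derivative (Z Z1 : R -> 'cV[R[i]]_2) : Prop :=
  forall i : 'I_2,
    H1_derivative_complex (fun y => Z y i 0) (fun y => Z1 y i 0).

(* Graph of the operator S(d/dy) on L^2(R, C^2) with domain H^2(R, C^2), for a
   matrix S of polynomials of degree at most 2 in the indeterminate D = 'X. *)
Definition operator_graph (S : 'M[{poly R[i]}]_2)
    (Z g : R -> 'cV[R[i]]_2) : Prop :=
  exists Z1 Z2 : R -> 'cV[R[i]]_2,
    [/\ H1_derivative Z Z1, H1_derivative Z1 Z2 &
        {ae mu, forall y, g y = map_mx (coefp 0) S *m Z y +
                                map_mx (coefp 1) S *m Z1 y +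
                                map_mx (coefp 2) S *m Z2 y}].

(* Bijective from its domain onto L^2(R, C^2), with bounded inverse. *)
Definition operator_invertible (S : 'M[{poly R[i]}]_2) : Prop :=
  [/\ forall Z, operator_graph S Z (fun=> 0) -> {ae mu, forall y, Z y = 0},
      forall g, L2 g -> exists Z, operator_graph S Z g &
      exists M : R, forall Z g, L2 g -> operator_graph S Z g ->
        (L2_norm Z <= M%:E * L2_norm g)%E].

End SobolevSpaces.

Section PlaneWaveSpectrum.
Context {R : realType}.

Definition mx22 (T : Type) (a b c d : T) : 'M[T]_2 :=
  \matrix_(i < 2, j < 2)
    if i == 0 then (if j == 0 then a else b) else (if j == 0 then c else d).

(* Real coefficients, as constant polynomials in the symbol D = 'X. *)
Local Notation "x %:S" := ((x%:C)%:P : {poly R[i]}) (at level 2).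

(* With u(x, t) = a exp(ikx + iwt) (1 + z(x - ct, t)), linearizing
   u_tt - u_xx + f(|u|^2) u = 0 in Z = (Re z, Im z) about 0 gives
   Z_tt + J_c(d/dy) Z_t + H_c(d/dy) Z = 0. *)
Definition J_symbol (c w : R) : 'M[{poly R[i]}]_2 :=
  mx22 (- (2 * c)%:S * 'X) (- (2 * w)%:S)
       ((2 * w)%:S)        (- (2 * c)%:S * 'X).

Definition H_symbol (f : R -> R) (a k w c : R) : 'M[{poly R[i]}]_2 :=
  mx22 (- (1 - c ^+ 2)%:S * 'X^2 + (2 * a ^+ 2 * derive1 f (a ^+ 2))%:S)
       ((2 * (c * w + k))%:S * 'X)
       (- (2 * (c * w + k))%:S * 'X)
       (- (1 - c ^+ 2)%:S * 'X^2).

Definition P_symbol (f : R -> R) (a k w c : R) (lambda : R[i])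
    : 'M[{poly R[i]}]_2 :=
  ((lambda ^+ 2)%:P)%:M + lambda%:P *: J_symbol c w + H_symbol f a k w c.

Definition spectrum (f : R -> R) (a k w c : R) : set R[i] :=
  [set lambda | ~ operator_invertible (P_symbol f a k w c lambda)].

Definition spectrally_stable (f : R -> R) (a k w c : R) : Prop :=
  spectrum f a k w c `<=` [set lambda | complex.Re lambda = 0].

Definition spectrally_unstable (f : R -> R) (a k w c : R) : Prop :=
  ~ spectrally_stable f a k w c.

End PlaneWaveSpectrum.

(* Main.v *)
(* Put D = d/dy and W = (lambda - (c + s) D) Z, which amounts to observing the wave
   from a frame of another speed -s. Pairing P_c(lambda) Z with W gives Re lambda
   times |W|^2 + (1 - s^2) |Z'|^2 + 2 b |Z_1|^2 + 4 (k - w s) Re (Z_2' conj Z_1),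
   where b = a^2 f'(a^2), up to a derivative. Under the stability conditions this
   form is nonnegative for s = k / w if f(a^2) > 0 and for s = w / k if f(a^2) < 0,
   so |Z| <= |P_c(lambda) Z| / (Re lambda)^2 in L^2 when Re lambda <> 0. The same
   computation on Z = e^(i l y) v shows that the quartic det P_c(lambda) has no
   imaginary root; it is then inverted on L^2 by four successive first-order
   resolvents (D - r)^(-1), and P_c(lambda) by means of its adjugate.

   Conversely, a root i l of det P_c(lambda) yields a Weyl sequence. On D = i l and
   lambda = i l (z + c), det P_c(lambda) = l^2 (l^2 (z^2 - 1)^2 - q(z)), where the real
   quadratic q has discriminant 16 b (b + 2 f(a^2)), which is negative under the
   instability conditions. Then for small l the quartic has a non-real root z,
   whence Re lambda <> 0. *)
Require Import Defs.
From HB Require Import structures.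
From mathcomp Require Import all_boot all_order all_algebra.
From mathcomp Require Import complex.
From mathcomp Require Import all_classical all_reals all_analysis.
From mathcomp Require Import measurable_realfun.
From mathcomp Require Import ring lra.

Set Implicit Arguments.
Unset Strict Implicit.
Unset Printing Implicit Defensive.

Import Order.TTheory GRing.Theory Num.Theory.
Import numFieldNormedType.Exports.

Local Open Scope classical_set_scope.
Local Open Scope ring_scope.
Local Open Scope complex_scope.

(** * Locally absolutely continuous functions *)

Section Primitive.
Context {R : realType}.
Implicit Types u v w F f g : R -> R.
Local Notation mu := (@lebesgue_measure R).

Definition loc_integrable v := forall x y : R, mu.-integrable `[x, y] (EFin \o v).

(** Local absolute continuity of [u] with derivative [v], in integral form, which is insensitive to
    null sets. Local integrability is part of it because the real-valued integral has a default
    value otherwise. *)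
Definition primitive u v := loc_integrable v /\
  forall x y, x <= y -> u y - u x = \int[mu]_(t in `[x, y]) v t.

Lemma eq_loc_integrable v w : v =1 w -> loc_integrable v -> loc_integrable w.
Proof. by move=> /funext ->. Qed.

Lemma loc_integrableD v w : loc_integrable v -> loc_integrable w ->
  loc_integrable (fun t => v t + w t).
Proof.
move=> iv iw x y; by apply: (eq_integrable _ _ _ _ (integrableD _ (iv x y) (iw x y))).
Qed.

Lemma loc_integrableZ (a : R) v : loc_integrable v ->
  loc_integrable (fun t => a * v t).
Proof.
move=> iv x y; by apply: (eq_integrable _ _ _ _ (integrableZl _ a (iv x y))).
Qed.

Lemma loc_integrable_norm v : loc_integrable v ->
  loc_integrable (fun t => `|v t|).
Proof. by move=> iv x y; have := integrable_norm (iv x y). Qed.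

Lemma continuous_loc_integrable v : continuous v -> loc_integrable v.
Proof.
move=> cv x y; apply: continuous_compact_integrable; first exact: segment_compact.
exact: continuous_subspaceT.
Qed.

Lemma loc_integrableM v w : continuous v -> loc_integrable w ->
  loc_integrable (fun t => v t * w t).
Proof.
move=> cv iw x y; apply: (integrableMr _ _ _ (iw x y)) => //.
  by apply: measurable_funTS; apply: continuous_measurable_fun.
have : compact (v @` `[x, y]).
  by apply: continuous_compact; [exact: continuous_subspaceT|exact: segment_compact].
move=> /compact_bounded [M [Mr HM]]; exists M; split => // z Mz t /= txy.
by apply: HM => //; exists t.
Qed.

Lemma loc_integrable_le v w : measurable_fun setT v ->
  (forall t, `|v t| <= w t) -> loc_integrable w -> loc_integrable v.
Proof.
move=> mv vw iw x y; apply: (le_integrable _ _ _ (iw x y)) => //.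
  by apply/measurable_EFinP; apply: measurable_funTS.
by move=> t _; rewrite lee_fin (le_trans (vw t))// ler_norm.
Qed.

Lemma Rintegral_chasles v x y z : loc_integrable v -> x <= y -> y <= z ->
  \int[mu]_(t in `[x, z]) v t =
  \int[mu]_(t in `[x, y]) v t + \int[mu]_(t in `[y, z]) v t.
Proof.
move=> iv xy yz; rewrite -(Rintegral_itv_obnd_cbnd (r := y)); last first.
  apply: integrableS (iv y z) => // t /=.
  by rewrite !in_itv/= => /andP[/ltW-> ->].
rewrite -(@Rintegral_itvB _ v (BLeft x) (BRight z) y) ?bnd_simp//.
by rewrite addrC subrK.
Qed.

Lemma loc_integrable_primitive v : loc_integrable v -> exists u, primitive u v.
Proof.
move=> iv.
(* Integrals over sets carry no orientation, so the sign to the left of 0 is put in by hand. *)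
pose u y := if 0 <= y then \int[mu]_(t in `[0, y]) v t
            else - \int[mu]_(t in `[y, 0]) v t.
exists u; split => // x y xy; rewrite /u.
have [x0|x0] := leP 0 x.
  by rewrite (le_trans x0 xy) (Rintegral_chasles iv x0 xy) addrAC subrr add0r.
have [y0|y0] := leP 0 y.
  by rewrite (Rintegral_chasles iv (ltW x0) y0) opprK addrC.
by rewrite (Rintegral_chasles iv xy (ltW y0)) opprK addrC addrK.
Qed.

Lemma eq_primitive u v v' : v =1 v' -> primitive u v -> primitive u v'.
Proof. by move=> /funext ->. Qed.

Lemma primitiveD u u' v v' : primitive u u' -> primitive v v' ->
  primitive (fun t => u t + v t) (fun t => u' t + v' t).
Proof.
move=> [iu pu] [iv pv]; split; first exact: loc_integrableD.
move=> x y xy; rewrite RintegralD//.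
by rewrite -pu// -pv// opprD addrACA.
Qed.

Lemma primitiveZ (a : R) u u' : primitive u u' ->
  primitive (fun t => a * u t) (fun t => a * u' t).
Proof.
move=> [iu pu]; split; first exact: loc_integrableZ.
by move=> x y xy; rewrite RintegralZl// -pu// mulrBr.
Qed.

(** Near [x], [u] is [u (x - 1)] plus an indefinite integral over [[x - 1, x + 1]], which is
    continuous in its upper bound. *)
Lemma primitive_continuous u v : primitive u v -> continuous u.
Proof.
move=> [iv pu] x.
have lt1 : x - 1 < x + 1 by rewrite ltrD2l; lra.
have := parameterized_integral_continuous (ltW lt1) (iv (x - 1) (x + 1)).
move=> /(continuous_within_itvP _ lt1)[+ _ _].
move=> /(_ x); rewrite in_itv/= ltrDl ltr01 gtrBl ltr01 => /(_ isT) cI.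
have cI2 : (fun y => u (x - 1) + parameterized_integral mu (x - 1) y v) y @[y --> x] -->
    u (x - 1) + parameterized_integral mu (x - 1) x v.
  by apply: cvgD cI; exact: cvg_cst.
have E y : x - 1 <= y -> u (x - 1) + parameterized_integral mu (x - 1) y v = u y.
  by move=> h; rewrite /parameterized_integral -pu// addrC subrK.
rewrite E in cI2; last by lra.
apply: cvg_trans cI2; apply: near_eq_cvg; near=> y; rewrite E//.
apply: ltW; near: y; apply: lt_nbhsr; lra.
Unshelve. all: by end_near. Qed.

(* Halving the increment of Phi, by the intermediate value theorem, halves the
   bound on the increment of G. *)
Lemma eq_of_sqr_increments (G Phi : R -> R) (x y : R) : continuous Phi ->
  (forall x y : R, x <= y -> Phi x <= Phi y) ->
  (forall x y : R, x <= y -> `|G y - G x| <= (Phi y - Phi x) ^+ 2) ->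
  x <= y -> G y = G x.
Proof.
move=> cP nP GP xy.
have H n : forall x y, x <= y -> `|G y - G x| <= (Phi y - Phi x) ^+ 2 / 2 ^+ n.
  elim: n => [|n IH] {x xy}x {}y xy; first by rewrite expr0 divr1 GP.
  pose m := (Phi x + Phi y) / 2.
  have [z /[!in_itv]/= /andP[xz zy] Pz] : exists2 z, z \in `[x, y] & Phi z = m.
    apply: IVT => //; first exact: continuous_subspaceT.
    rewrite (min_idPl (nP _ _ xy)) (max_idPr (nP _ _ xy)) /m.
    by have := nP _ _ xy => ?; apply/andP; split; lra.
  have -> : G y - G x = (G y - G z) + (G z - G x) by rewrite addrA subrK.
  apply: (le_trans (ler_normD _ _)).
  apply: (le_trans (lerD (IH _ _ zy) (IH _ _ xz))).
  rewrite Pz /m -mulrDl [2 ^+ n.+1]exprS invfM mulrA ler_pM2r ?invr_gt0 ?exprn_gt0//.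
  nra.
apply/eqP; rewrite -subr_eq0 -normr_le0.
have c0 : (Phi y - Phi x) ^+ 2 / 2 ^+ n @[n --> \oo] --> (0 : R).
  rewrite -[0](mulr0 ((Phi y - Phi x) ^+ 2)); apply: cvgM; first exact: cvg_cst.
  under eq_fun do rewrite -exprVn.
  by apply: cvg_expr; rewrite ger0_norm//; lra.
by apply: (cvgr_to_ge c0); apply: nearW => n; exact: H.
Qed.

Lemma Rintegral_ge0_subset v a b x y : loc_integrable v ->
  (forall t, 0 <= v t) -> a <= x -> x <= y -> y <= b ->
  \int[mu]_(t in `[x, y]) v t <= \int[mu]_(t in `[a, b]) v t.
Proof.
move=> iv v0 ax xy yb.
rewrite (Rintegral_chasles iv ax (le_trans xy yb)) (Rintegral_chasles iv xy yb).
have := @Rintegral_ge0 _ _ _ mu `[a, x] v (fun t _ => v0 t).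
have := @Rintegral_ge0 _ _ _ mu `[y, b] v (fun t _ => v0 t).
lra.
Qed.

(* The defect in the product rule over [x, y] is at most the square of the
   integral of |u'| + |v'|, hence vanishes. *)
Lemma primitiveM u u' v v' : primitive u u' -> primitive v v' ->
  primitive (fun t => u t * v t) (fun t => u' t * v t + u t * v' t).
Proof.
move=> pu pv; have cu := primitive_continuous pu.
have cv := primitive_continuous pv; have [iu Eu] := pu; have [iv Ev] := pv.
have iu'v : loc_integrable (fun t => u' t * v t).
  by apply: (eq_loc_integrable _ (loc_integrableM cv iu)) => t; rewrite mulrC.
have iuv' : loc_integrable (fun t => u t * v' t) by exact: loc_integrableM.
have iS := loc_integrableD iu'v iuv'.
have [K [_ EK]] := loc_integrable_primitive iS.
split => // x y xy; rewrite -EK//.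
(* [K] is a primitive of the expected derivative, so it remains to see that [u v - K] is
   constant. *)
suff : u y * v y - K y = u x * v x - K x by lra.
pose w t := `|u' t| + `|v' t|.
have iw : loc_integrable w by apply: loc_integrableD; exact: loc_integrable_norm.
have w0 t : 0 <= w t by rewrite addr_ge0.
have [Phi pPhi] := loc_integrable_primitive iw; have [_ EPhi] := pPhi.
apply: (@eq_of_sqr_increments (fun t => u t * v t - K t) Phi) xy.
- exact: primitive_continuous pPhi.
- by move=> {}x {}y xy; rewrite -subr_ge0 EPhi// Rintegral_ge0.
move=> {}x {}y xy.
have bound f g s t : primitive f g -> (forall r, `|g r| <= w r) ->
    x <= s -> s <= t -> t <= y -> `|f t - f s| <= Phi y - Phi x.
  move=> [ig Ef] gw xs st ty; rewrite Ef// EPhi//.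
  apply: (le_trans (le_normr_Rintegral _ (ig s t))) => //.
  apply: le_trans (Rintegral_ge0_subset iw w0 xs st ty).
  apply: le_Rintegral => //; exact: (loc_integrable_norm ig).
have uw r : `|u' r| <= w r by rewrite lerDl.
have vw r : `|v' r| <= w r by rewrite lerDr.
have i1 : loc_integrable (fun s => u' s * (v y - v s)).
  apply: (eq_loc_integrable (v := fun s => (v y - v s) * u' s)) => [s|].
    by rewrite mulrC.
  apply: loc_integrableM => //; move=> s.
  by apply: cvgB; [exact: cvg_cst|exact: cv].
have i2 : loc_integrable (fun s => (u x - u s) * v' s).
  apply: loc_integrableM => //; move=> s.
  by apply: cvgB; [exact: cvg_cst|exact: cu].
(* Each term of this form of the defect is a derivative times an increment over a subinterval, and
   [bound] controls the increments. *)
have -> : u y * v y - K y - (u x * v x - K x) =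
    \int[mu]_(s in `[x, y]) (u' s * (v y - v s) + (u x - u s) * v' s).
  have -> : u y * v y - K y - (u x * v x - K x) =
    v y * (u y - u x) + u x * (v y - v x) - (K y - K x) by ring.
  rewrite Eu// Ev// EK// -RintegralZl//.
  rewrite -RintegralZl//.
  have ivu := loc_integrableZ (v y) iu; have iuv := loc_integrableZ (u x) iv.
  rewrite -RintegralD// -RintegralB//; last exact: (loc_integrableD ivu iuv).
  by apply: eq_Rintegral => s _; ring.
apply: (le_trans (le_normr_Rintegral _ (loc_integrableD i1 i2 x y))) => //.
rewrite expr2 [X in _ <= _ * X]EPhi// -RintegralZl//.
apply: le_Rintegral => //; [exact: (loc_integrable_norm (loc_integrableD i1 i2))|
  exact: (loc_integrableZ _ iw)|].
move=> s /=; rewrite in_itv/= => /andP[xs sy].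
apply: (le_trans (ler_normD _ _)); rewrite !normrM mulrDr.
rewrite [X in X + _ <= _]mulrC; apply: lerD; rewrite ler_wpM2r//.
  exact: (bound v v').
by rewrite distrC; exact: (bound u u').
Qed.

Lemma derive_primitive F f : (forall x, is_derive x (1 : R) F (f x)) ->
  continuous f -> primitive F f.
Proof.
move=> dF cf; split; first exact: continuous_loc_integrable.
have cF : continuous F.
  by move=> z; apply: differentiable_continuous; apply/derivable1_diffP; exact: ex_derive.
move=> x y; rewrite le_eqVlt => /predU1P[->|xy].
  by rewrite subrr set_itv1 Rintegral_set1.
rewrite /Rintegral (@continuous_FTC2 _ f F)//.
- exact: continuous_subspaceT.
- split.
  + by move=> z _; exact: ex_derive.
  + exact/cvg_at_right_filter/cF.
  + exact/cvg_at_left_filter/cF.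
- by move=> z _; rewrite derive1E; exact: derive_val.
Qed.

End Primitive.

(** * Square integrable functions *)

Section SquareIntegrable.
Context {R : realType}.
Implicit Types u v w F G : R -> R.
Local Notation mu := (@lebesgue_measure R).
Local Notation L2r := (Lfun mu 2%:E).

Lemma Lfun2_measurable u : u \in L2r -> measurable_fun setT u.
Proof. by rewrite inE => /andP[]; rewrite inE. Qed.

Lemma sqr_integrable_Lfun2 u : measurable_fun setT u ->
  mu.-integrable setT (EFin \o (fun t => u t ^+ 2)) -> u \in L2r.
Proof.
move=> m1 iu; rewrite inE; apply/andP; split; first by rewrite inE.
rewrite inE /finite_norm unlock/=; rewrite poweR_lty//.
move/integrableP : iu => [_]; apply: le_lt_trans.
apply: ge0_le_integral => //.
- apply/measurable_EFinP; apply: (measurableT_comp (measurable_powR _)).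
  exact: measurableT_comp.
- apply/measurable_EFinP; apply: measurableT_comp => //.
  exact: measurable_funX.
- move=> t _ /=; rewrite lee_fin powR_mulrn// -normrX//.
Qed.

Lemma Lfun2D u v : u \in L2r -> v \in L2r -> (fun t => u t + v t) \in L2r.
Proof. by move=> hu hv; apply: (Lfun_addr_closed mu _).2 => //; rewrite lee_fin ler1n. Qed.

Lemma Lfun2Z (a : R) u : u \in L2r -> (fun t => a * u t) \in L2r.
Proof.
move=> hu; have := @Lfun_scale _ _ _ mu u a 2 (ler1n _ _) hu.
by under eq_fun do rewrite mulrC.
Qed.

Lemma Lfun2_mul_integrable u v : u \in L2r -> v \in L2r ->
  mu.-integrable setT (EFin \o (fun t => u t * v t)).
Proof. by move=> hu hv; apply/Lfun1_integrable; exact: Lfun2_mul_Lfun1. Qed.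

Lemma Lfun2_loc_integrable u : u \in L2r -> loc_integrable u.
Proof.
move=> hu; apply: (@loc_integrable_le _ _ (fun t => 1 + u t ^+ 2)).
- exact: Lfun2_measurable.
- move=> t; rewrite -(real_normK (num_real (u t))); set z := `|u t|.
  by have : 0 <= z := normr_ge0 _; nra.
- apply: loc_integrableD; first by apply: continuous_loc_integrable; exact: cst_continuous.
  by move=> x y; apply: (integrableS _ _ _ (Lfun2_integrable_sqr hu)).
Qed.

Lemma Lfun2_le u v (M : R) : measurable_fun setT u -> v \in L2r ->
  (forall t, `|u t| <= M * `|v t|) -> u \in L2r.
Proof.
move=> m1 hv uv; apply: sqr_integrable_Lfun2 => //.
have := Lfun2_integrable_sqr (Lfun2Z M hv).
apply: le_integrable => //.
  by apply/measurable_EFinP/measurable_funX.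
move=> t _ /=; rewrite lee_fin !normrX ler_pXn2r ?nnegrE// (le_trans (uv t))//.
by rewrite normrM ler_wpM2r// ler_norm.
Qed.

(** Monotone convergence along the intervals [-n, n]. *)
Lemma ge0_integral_le_bounded F (K : R) : measurable_fun setT F ->
  (forall t, 0 <= F t) ->
  (forall n : nat, (\int[mu]_(t in `[(- n%:R)%R, n%:R%R]) (F t)%:E <= K%:E)%E) ->
  (\int[mu]_t (F t)%:E <= K%:E)%E.
Proof.
move=> mF F0 FK.
have E : \bigcup_(n : nat) (`[- n%:R, n%:R]%classic : set R) = setT.
  apply/seteqP; split => // t _; exists (Num.truncn `|t|).+1 => //=.
  rewrite in_itv/= -ler_norml; apply/ltW/truncnS_gt.
have := @ge0_nondecreasing_set_cvg_integral _ _ R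
  (fun n : nat => (`[- n%:R, n%:R]%classic : set (measurableTypeR R))) (EFin \o F) mu.
rewrite E =>  H.
have {}H : (\int[mu]_(t in `[(- n%:R)%R, n%:R%R]) (F t)%:E)%E @[n --> \oo] -->
    (\int[mu]_t (F t)%:E)%E.
  apply: H => //.
  - move=> n m nm; rewrite subsetEset => t /=; rewrite !in_itv/= => /andP[a b].
    have : n%:R <= m%:R :> R by rewrite ler_nat.
    by move=> ?; apply/andP; split; lra.
  - by move=> n; apply/measurable_EFinP; apply: measurable_funTS.
  - by move=> n t _; rewrite lee_fin.
rewrite -(cvg_lim _ H)//; apply: lime_le; first exact: cvgP H.
by apply: nearW => n; exact: FK.
Qed.

(** Otherwise |Phi| would be at least [e] on a set of infinite measure. This provides far away
    endpoints at which an integrable flux is small. *)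
Lemma integrable_small (Phi : R -> R) (e : R) (A : set R) :
  mu.-integrable setT (EFin \o Phi) -> measurable A -> mu A = +oo%E ->
  0 < e -> exists2 y, A y & `|Phi y| < e.
Proof.
move=> iP mA Aoo e0; apply: contrapT => H.
have Pe y : A y -> e <= `|Phi y|.
  by move=> Ay; rewrite leNgt; apply/negP => lt; apply: H; exists y.
have iPA : mu.-integrable A (EFin \o Phi) by apply: integrableS iP.
move/integrableP : iPA => [mP]; apply/negP; rewrite -leNgt.
have -> : +oo%E = (\int[mu]_(t in A) (cst e%:E t))%E.
  rewrite integral_cst//; transitivity (e%:E * +oo)%E; first by rewrite gt0_muley.
  by congr (_ * _)%E.
apply: ge0_le_integral => //.
- by move=> t _; rewrite lee_fin ltW.
- exact: measurableT_comp.
Qed.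

End SquareIntegrable.

(** * The equation u' = r u + g in L^2 *)

Section RealResolvent.
Context {R : realType}.
Implicit Types u v w F G g : R -> R.
Local Notation mu := (@lebesgue_measure R).
Local Notation L2r := (Lfun mu 2%:E).

Lemma ae_imply (P Q : R -> Prop) : (forall t, P t -> Q t) ->
  {ae mu, forall t, P t} -> {ae mu, forall t, Q t}.
Proof.
by move=> PQ [N [mN N0 sub]]; exists N; split => // t Qt; apply: sub => /PQ.
Qed.

Lemma ae_and (P Q : R -> Prop) : {ae mu, forall t, P t} ->
  {ae mu, forall t, Q t} -> {ae mu, forall t, P t /\ Q t}.
Proof.
move=> aP aQ; exact: (@filterI _ _ (ae_filter_ringOfSetsType mu) _ _ aP aQ).
Qed.

(* Phi is the flux of an energy balance; no limits are needed, since it suffices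
   to control it along suitable endpoints going to both ends of the line. *)
Lemma integral_le_flux F G (Phi phi : R -> R) (C : R) :
  measurable_fun setT F -> (forall t, 0 <= F t) ->
  (forall t, 0 <= G t) -> mu.-integrable setT (EFin \o G) ->
  primitive Phi phi ->
  (forall N : R, exists x y, [/\ x <= - N, N <= y & Phi x - Phi y <= C]) ->
  {ae mu, forall t, F t + phi t <= G t} ->
  (\int[mu]_t (F t)%:E <= \int[mu]_t (G t)%:E + C%:E)%E.
Proof.
move=> mF F0 G0 iG pP HC ae.
have Gfin : (\int[mu]_t (G t)%:E)%E \is a fin_num by exact: integrable_fin_num.
rewrite -(fineK Gfin) -EFinD; apply: ge0_integral_le_bounded => // n.
have [x [y [xn ny PC]]] := HC n%:R.
have n0 : 0 <= n%:R :> R by [].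
have xy : x <= y by lra.
have [iphi Ephi] := pP.
have iGl : loc_integrable G by move=> a b; exact: integrableS iG.
have iH : loc_integrable (fun t => G t - phi t).
  apply: (eq_loc_integrable _ (loc_integrableD iGl (loc_integrableZ (-1) iphi))).
  by move=> t; rewrite mulN1r.
have mH := measurable_int _ (iH x y).
have mFxy : measurable_fun `[x, y] (EFin \o F).
  by apply/measurable_EFinP; exact: measurable_funTS.
apply: (@le_trans _ _ (\int[mu]_(t in `[x, y]) (F t)%:E)%E).
  apply: ge0_subset_integral => //; first by move=> t _; rewrite lee_fin.
  move=> t /=; rewrite !in_itv/= => /andP[a b]; apply/andP; split; lra.
(* The absolute value makes the integrand nonnegative everywhere; it changes [G - phi] only on a
   null set, since [G - phi] is at least [F] almost everywhere. *)
apply: (@le_trans _ _ (\int[mu]_(t in `[x, y]) `|(G t - phi t)%R%:E|)%E).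
  apply: ae_ge0_le_integral => //; first by move=> t _; rewrite lee_fin.
    exact: measurableT_comp mH.
  move: ae; apply: ae_imply => t h _; rewrite lee_fin.
  by apply: le_trans (ler_norm _); lra.
rewrite (@ae_eq_integral _ _ _ mu `[x, y] (fun t => (G t - phi t)%R%:E))//; last 2 first.
- exact: measurableT_comp mH.
- move: ae; apply: ae_imply => t h _ /=; rewrite ger0_norm//.
  by have := F0 t; lra.
have -> : (\int[mu]_(t in `[x, y]) (G t - phi t)%R%:E =
    (\int[mu]_(t in `[x, y]) (G t - phi t))%R%:E)%E.
  by rewrite fineK//; exact: integrable_fin_num (iH x y).
rewrite lee_fin RintegralB//.
rewrite -Ephi//.
have : \int[mu]_(t in `[x, y]) G t <= fine (\int[mu]_t (G t)%:E)%E.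
  apply: fine_le => //; first exact: integrable_fin_num (iGl x y).
  apply: ge0_subset_integral => //; first exact: measurable_int iG.
  by move=> t _; rewrite lee_fin.
lra.
Qed.

(** An integrable flux takes values below e / 2 in modulus arbitrarily far out on both sides, so its
    net contribution is at most any given e > 0. *)
Lemma integral_le_integrable_flux F G (Phi phi : R -> R) :
  measurable_fun setT F -> (forall t, 0 <= F t) ->
  (forall t, 0 <= G t) -> mu.-integrable setT (EFin \o G) ->
  primitive Phi phi -> mu.-integrable setT (EFin \o Phi) ->
  {ae mu, forall t, F t + phi t <= G t} ->
  (\int[mu]_t (F t)%:E <= \int[mu]_t (G t)%:E)%E.
Proof.
move=> mF F0 G0 iG pP iP ae; apply/lee_addgt0Pr => e e0.
apply: (integral_le_flux (Phi := Phi) (phi := phi)) => // N.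
have e20 : 0 < e / 2 by lra.
have [|x] := integrable_small iP (measurable_itv `]-oo, (- N)]) _ e20.
  by rewrite lebesgue_measure_itv/= ?ltNyr ?ltry.
rewrite /= in_itv/= => xN Px.
have [|y] := integrable_small iP (measurable_itv `[N, +oo[) _ e20.
  by rewrite lebesgue_measure_itv/= ?ltNyr ?ltry.
rewrite /= in_itv/= andbT => Ny Py.
exists x, y; split => //.
move: Px Py; rewrite !ltr_norml => /andP[? ?] /andP[? ?]; lra.
Qed.

Lemma is_derive_scale F (f : R -> R) (c x : R) : (forall t, is_derive t (1 : R) F (f t)) ->
  is_derive x (1 : R) (fun t => F (c * t)) (c * f (c * x)).
Proof.
move=> dF; rewrite mulrC; apply: is_derive1_comp => //.
have := is_deriveZ c (is_derive_id x 1).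
by rewrite /GRing.scale/= mulr1.
Qed.

Lemma primitive_expR (c : R) :
  primitive (fun t => expR (c * t)) (fun t => c * expR (c * t)).
Proof.
apply: derive_primitive => [x|x].
  by apply: is_derive_scale => t; exact: is_derive_expR.
apply: cvgM; first exact: cvg_cst.
apply: continuous_comp; last exact: continuous_expR.
by apply: cvgM; [exact: cvg_cst|exact: cvg_id].
Qed.

(* v = e^(alpha y) (H - C), where H is a primitive of e^(- alpha y) g and C is
   its limit at the end of the line at which e^(- alpha y) vanishes. *)
Lemma real_resolvent (alpha : R) g : alpha != 0 -> g \in L2r ->
  exists2 v, primitive v (fun t => alpha * v t + g t) & v \in L2r.
Proof.
move=> a0 hg; pose e t := expR (- alpha * t).
have pe : primitive e (fun t => - alpha * e t) by exact: primitive_expR.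
have ce := primitive_continuous pe.
have ig := Lfun2_loc_integrable hg.
have ieg : loc_integrable (fun t => e t * g t) by exact: loc_integrableM.
have [H pH] := loc_integrable_primitive ieg; have [_ EH] := pH.
have ig2 := Lfun2_integrable_sqr hg.
have g2fin := integrable_fin_num measurableT ig2.
have ig2l : loc_integrable (fun t => g t ^+ 2) by move=> a b; exact: integrableS ig2.
pose K := \int[mu]_t (g t ^+ 2).
have g2K x y : \int[mu]_(t in `[x, y]) (g t ^+ 2) <= K.
  apply: fine_le => //; first exact: integrable_fin_num (ig2l x y).
  apply: ge0_subset_integral => //; first exact: measurable_int ig2.
  by move=> t _; rewrite lee_fin sqr_ge0.
have e0 t : 0 < e t by exact: expR_gt0.
(* With m = e x + e y, Young's inequality gives |e g| <= e^2 / (2 m) + m g^2 / 2. The integral of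
   e^2 over [x, y] is at most m^2 / (2 |alpha|) and that of g^2 at most K, which sums to B m. *)
pose B := ((2 * `|alpha|)^-1 + K) / 2.
have na0 : 0 < `|alpha| by rewrite normr_gt0.
have incr x y : x <= y -> `|H y - H x| <= B * (e x + e y).
  move=> xy; rewrite EH//; pose m := e x + e y.
  have m0 : 0 < m by rewrite addr_gt0.
  apply: (le_trans (le_normr_Rintegral _ (ieg x y))) => //.
  have pe2 : primitive (fun t => (- alpha)^-1 * e t ^+ 2 / 2) (fun t => e t ^+ 2).
    have := primitiveZ ((- alpha)^-1 / 2) (primitiveM pe pe).
    have -> : (fun t => (- alpha)^-1 / 2 * (e t * e t)) = (fun t => (- alpha)^-1 * e t ^+ 2 / 2).
      by apply/funext => t; rewrite expr2; lra.
    by apply: eq_primitive => t; field.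
  have [ie2 Ee2] := pe2.
  have iY : loc_integrable (fun t => m^-1 / 2 * e t ^+ 2 + m / 2 * g t ^+ 2).
    by apply: loc_integrableD; exact: loc_integrableZ.
  apply: (@le_trans _ _ (\int[mu]_(t in `[x, y]) (m^-1 / 2 * e t ^+ 2 + m / 2 * g t ^+ 2))).
    apply: le_Rintegral => //; first exact: (loc_integrable_norm ieg).
    move=> t _; rewrite -subr_ge0.
    have -> : m^-1 / 2 * e t ^+ 2 + m / 2 * g t ^+ 2 - `|e t * g t| =
        (e t - m * `|g t|) ^+ 2 / (2 * m).
      rewrite normrM gtr0_norm// -(real_normK (num_real (g t))).
      by field; rewrite gt_eqF.
    by rewrite divr_ge0 ?sqr_ge0// mulr_ge0// ltW.
  rewrite RintegralD//; [|exact: (loc_integrableZ _ ie2)|exact: (loc_integrableZ _ ig2l)].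
  rewrite !RintegralZl//.
  rewrite -Ee2// /B -/m.
  have E2 : (- alpha)^-1 * e y ^+ 2 / 2 - (- alpha)^-1 * e x ^+ 2 / 2 <=
      `|alpha|^-1 / 2 * m ^+ 2.
    apply: (le_trans (ler_norm _)).
    rewrite -mulrBl -mulrBr !normrM normfV normrN (@gtr0_norm _ 2^-1) ?invr_gt0//.
    rewrite mulrAC ler_wpM2l ?divr_ge0//.
    rewrite ler_norml /m; have := e0 x; have := e0 y => ? ?.
    by apply/andP; split; nra.
  have -> : ((2 * `|alpha|)^-1 + K) / 2 * m =
     m^-1 / 2 * (`|alpha|^-1 / 2 * m ^+ 2) + m / 2 * K.
    by field; rewrite !gt_eqF.
  apply: lerD; rewrite ler_wpM2l//; first by rewrite divr_ge0// invr_ge0 ltW.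
  by rewrite divr_ge0// ltW.
have incr' x y : `|H y - H x| <= B * (e x + e y).
  by have [xy|/ltW yx] := leP x y; [exact: incr|rewrite distrC [e x + e y]addrC; exact: incr].
(* By [incr'], every [H y - B * e y] lies below every [H z + B * e z]. The supremum of the former is
   thus within [B * e y] of each [H y], and both signs of [alpha] are treated at once. *)
pose S := [set H y - B * e y | y in setT].
pose C := sup S.
have ubS z : ubound S (H z + B * e z).
  move=> _ [y _ <-]; have := incr' y z; rewrite mulrDr ler_norml => /andP[]; lra.
have HC y : `|H y - C| <= B * e y.
  have ? : H y - B * e y <= C.
    by apply: ub_le_sup; [exists (H 0 + B * e 0); exact: ubS|exists y].
  have ? : C <= H y + B * e y.
    by apply: ge_sup; [exists (H 0 - B * e 0); exists 0|exact: ubS].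
  by rewrite ler_norml; apply/andP; split; lra.
pose E t := expR (alpha * t).
have Ee t : E t * e t = 1 by rewrite /E /e -expRD mulNr addrN expR0.
have pE : primitive E (fun t => alpha * E t) by exact: primitive_expR.
have E0 t : 0 < E t by exact: expR_gt0.
pose v t := E t * (H t - C).
have pHC : primitive (fun t => H t - C) (fun t => e t * g t).
  by split => // x y xy; rewrite -EH//; lra.
have pv : primitive v (fun t => alpha * v t + g t).
  apply: eq_primitive (primitiveM pE pHC) => t.
  by rewrite mulrA Ee mul1r /v mulrA.
have vB t : `|v t| <= B.
  rewrite /v normrM gtr0_norm// -[leRHS]mulr1 -(Ee t) mulrCA ler_pM2l//.
have cv := primitive_continuous pv.
have mv : measurable_fun setT v by exact: continuous_measurable_fun.
exists v => //; apply: sqr_integrable_Lfun2 => //.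
have iGa : mu.-integrable setT (EFin \o (fun t => `|alpha|^-1 * g t ^+ 2)).
  by apply: (eq_integrable _ _ _ _ (integrableZl _ `|alpha|^-1 ig2)).
(* With the flux - sg(alpha) v^2 the balance between |alpha| v^2 and g^2 / |alpha| closes by the
   square (g + alpha v)^2 / |alpha|. The bound |v| <= B controls this flux at any endpoints. *)
have pP := primitiveZ (- Num.sg alpha) (primitiveM pv pv).
have mv2 : measurable_fun setT (fun t => v t ^+ 2) by exact: measurable_funX.
have le : (\int[mu]_t (`|alpha| * v t ^+ 2)%:E <=
    \int[mu]_t (`|alpha|^-1 * g t ^+ 2)%R%:E + (2 * B ^+ 2)%R%:E)%E.
  apply: (integral_le_flux _ _ _ iGa pP).
  - exact: measurable_funM.
  - by move=> t; rewrite mulr_ge0// sqr_ge0.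
  - by move=> t; rewrite mulr_ge0// ?invr_ge0// sqr_ge0.
  - move=> N; exists (- `|N|), `|N|; split; rewrite ?lerN2 ?ler_norm//.
    have sq t : v t * v t <= B ^+ 2.
      by rewrite -expr2 -(real_normK (num_real (v t))) ler_pXn2r ?nnegrE ?vB// (le_trans _ (vB t)).
    have := sq (- `|N|); have := sq `|N|.
    have := sqr_ge0 (v (- `|N|)); have := sqr_ge0 (v `|N|); rewrite !expr2.
    by case: sgrP => _; lra.
  - apply: nearW => t; rewrite -subr_ge0.
    have -> : `|alpha|^-1 * g t ^+ 2 - (`|alpha| * v t ^+ 2 +
        - Num.sg alpha * ((alpha * v t + g t) * v t + v t * (alpha * v t + g t))) =
        (g t + alpha * v t) ^+ 2 / `|alpha|.
      case: sgrP (a0) => [_ //|ap _|ap _]; field; first by rewrite gt_eqF.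
      by rewrite lt_eqF.
    by rewrite divr_ge0// sqr_ge0.
have mav : measurable_fun setT (EFin \o (fun t => `|alpha| * v t ^+ 2)).
  by apply/measurable_EFinP; exact: measurable_funM.
have iav : mu.-integrable setT (EFin \o (fun t => `|alpha| * v t ^+ 2)).
  apply/integrableP; split => //.
  under eq_integral => t _ do
    rewrite /= normrM normr_id (ger0_norm (sqr_ge0 _)).
  apply: (le_lt_trans le); apply: lte_add_pinfty; last exact: ltry.
  exact: (integrable_lty _ iGa).
apply: (eq_integrable _ _ _ _ (integrableZl _ `|alpha|^-1 iav)) => // t _ /=.
by rewrite -EFinM mulrA mulVf ?mul1r// gt_eqF.
Qed.

End RealResolvent.

(** * Complex-valued functions: representatives in H^1 and the resolvent of d/dy *)

Section ComplexResolvent.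
Context {R : realType}.
Local Notation C := R[i].
Implicit Types u v w g : R -> C.
Local Notation mu := (@lebesgue_measure R).
Local Notation L2r := (Lfun mu 2%:E).
Local Notation Re := complex.Re.
Local Notation Im := complex.Im.

Lemma ReD (x y : C) : Re (x + y) = Re x + Re y. Proof. by case: x y => [? ?] []. Qed.
Lemma ImD (x y : C) : Im (x + y) = Im x + Im y. Proof. by case: x y => [? ?] []. Qed.
Lemma ReN (x : C) : Re (- x) = - Re x. Proof. by case: x. Qed.
Lemma ImN (x : C) : Im (- x) = - Im x. Proof. by case: x. Qed.
Lemma ReM (x y : C) : Re (x * y) = Re x * Re y - Im x * Im y.
Proof. by case: x y => [? ?] []. Qed.
Lemma ImM (x y : C) : Im (x * y) = Re x * Im y + Im x * Re y.
Proof. by case: x y => [? ?] []. Qed.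
Lemma eqC (x y : C) : Re x = Re y -> Im x = Im y -> x = y.
Proof. by case: x y => [? ?] [? ?] /= -> ->. Qed.

Lemma L2_complexD u v : L2_complex u -> L2_complex v -> L2_complex (fun t => u t + v t).
Proof.
move=> [ru iu] [rv iv]; split.
  by under eq_fun do rewrite ReD; exact: Lfun2D.
by under eq_fun do rewrite ImD; exact: Lfun2D.
Qed.

Lemma L2_complexZ (c : C) u : L2_complex u -> L2_complex (fun t => c * u t).
Proof.
move=> [ru iu]; split.
  under eq_fun do rewrite ReM -mulNr; exact: Lfun2D (Lfun2Z _ ru) (Lfun2Z _ iu).
under eq_fun do rewrite ImM; exact: Lfun2D (Lfun2Z _ iu) (Lfun2Z _ ru).
Qed.

(* Same as H1_derivative_complex, but u itself is locally absolutely continuous. *)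
Definition H1_strong u v := [/\ L2_complex u, L2_complex v,
  primitive (fun t => Re (u t)) (fun t => Re (v t)) &
  primitive (fun t => Im (u t)) (fun t => Im (v t))].

Lemma H1_strongD u u' v v' : H1_strong u u' -> H1_strong v v' ->
  H1_strong (fun t => u t + v t) (fun t => u' t + v' t).
Proof.
move=> [lu lu' ru iu] [lv lv' rv iv]; split; try exact: L2_complexD.
  by under eq_fun do rewrite ReD; under [X in primitive _ X]eq_fun do rewrite ReD;
    exact: primitiveD.
by under eq_fun do rewrite ImD; under [X in primitive _ X]eq_fun do rewrite ImD;
  exact: primitiveD.
Qed.

Lemma H1_strongZ (c : C) u u' : H1_strong u u' ->
  H1_strong (fun t => c * u t) (fun t => c * u' t).
Proof.
move=> [lu lu' ru iu]; split; try exact: L2_complexZ.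
  under eq_fun do rewrite ReM -mulNr; under [X in primitive _ X]eq_fun do rewrite ReM -mulNr.
  exact: primitiveD (primitiveZ _ ru) (primitiveZ _ iu).
under eq_fun do rewrite ImM; under [X in primitive _ X]eq_fun do rewrite ImM.
exact: primitiveD (primitiveZ _ iu) (primitiveZ _ ru).
Qed.

Lemma H1_strong_derivative u v : H1_strong u v -> H1_derivative_complex u v.
Proof.
move=> [lu lv [_ ru] [_ iu]]; split => //; exists u; first exact: aeW.
move=> x y xy; apply: eqC; rewrite /complex_integral/=.
  by rewrite ReD ReN ru.
by rewrite ImD ImN iu.
Qed.

Lemma Lfun2_ae_eq (a b : R -> R) : a \in L2r -> measurable_fun setT b ->
  {ae mu, forall t, a t = b t} -> b \in L2r.
Proof.
move=> ha mb ab; apply: sqr_integrable_Lfun2 => //.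
have /integrableP[ma ia] := Lfun2_integrable_sqr ha.
have mb2 : measurable_fun setT (EFin \o (fun t => b t ^+ 2)).
  by apply/measurable_EFinP/measurable_funX.
apply/integrableP; split => //.
rewrite (@ae_eq_integral _ _ _ mu setT (fun t => `|(EFin \o (fun t => a t ^+ 2)%R) t|)%E)//.
- exact: measurableT_comp.
- exact: measurableT_comp.
- by move: ab; apply: ae_imply => t /= -> _.
Qed.

Lemma loc_integrable_ae_eq (a b : R -> R) : loc_integrable a -> measurable_fun setT b ->
  {ae mu, forall t, a t = b t} -> loc_integrable b /\
  forall x y, \int[mu]_(t in `[x, y]) b t = \int[mu]_(t in `[x, y]) a t.
Proof.
move=> ia mb ab.
have mbxy (x y : R) : measurable_fun (`[x, y]%classic : set (measurableTypeR R)) (EFin \o b).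
  by apply/measurable_EFinP; exact: measurable_funTS.
split => x y.
  have /integrableP[ma ia'] := ia x y; apply/integrableP; split => //.
  rewrite (@ae_eq_integral _ _ _ mu `[x, y] (fun t => `|(EFin \o a) t|)%E)//.
  - exact: measurableT_comp.
  - exact: measurableT_comp.
  - by move: ab; apply: ae_imply => t /= -> _.
congr fine; apply: ae_eq_integral => //.
  exact: measurable_int (ia x y).
by move: ab; apply: ae_imply => t /= -> _.
Qed.

Lemma ae_eq_map (S T : Type) (f : S -> T) (a b : R -> S) :
  {ae mu, forall t, a t = b t} -> {ae mu, forall t, f (a t) = f (b t)}.
Proof. by apply: ae_imply => t ->. Qed.

(** The integral of the derivative does not see null sets, so its representative can be prescribed.
    Representatives of a function and of its successive derivatives can thus be chosen consistently,
    starting from the highest one. *)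
Lemma H1_derivative_strong u v v' : H1_derivative_complex u v ->
  L2_complex v' -> {ae mu, forall t, v t = v' t} ->
  exists2 u', {ae mu, forall t, u t = u' t} & H1_strong u' v'.
Proof.
move=> [[ru iu] [rv iv] [u' uu' E]] lv' vv'; exists u' => //.
have [rv' iv'] := lv'.
have [li1 e1] := loc_integrable_ae_eq (Lfun2_loc_integrable rv) (Lfun2_measurable rv')
  (ae_eq_map (@complex.Re R) vv').
have [li2 e2] := loc_integrable_ae_eq (Lfun2_loc_integrable iv) (Lfun2_measurable iv')
  (ae_eq_map (@complex.Im R) vv').
have p1 : primitive (fun t => Re (u' t)) (fun t => Re (v' t)).
  by split => // x y xy; rewrite e1 -ReN -ReD E.
have p2 : primitive (fun t => Im (u' t)) (fun t => Im (v' t)).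
  by split => // x y xy; rewrite e2 -ImN -ImD E.
split => //; split.
  apply: (Lfun2_ae_eq ru); last exact: (ae_eq_map (@complex.Re R) uu').
  exact: continuous_measurable_fun (primitive_continuous p1).
apply: (Lfun2_ae_eq iu); last exact: (ae_eq_map (@complex.Im R) uu').
exact: continuous_measurable_fun (primitive_continuous p2).
Qed.

Lemma primitive_cos (b : R) : primitive (fun t => cos (b * t)) (fun t => - b * sin (b * t)).
Proof.
apply: derive_primitive => [x|x].
  by rewrite mulNr -mulrN; apply: is_derive_scale => t; exact: is_derive_cos.
apply: cvgM; first exact: cvg_cst.
apply: continuous_comp; last exact: continuous_sin.
by apply: cvgM; [exact: cvg_cst|exact: cvg_id].
Qed.

Lemma primitive_sin (b : R) : primitive (fun t => sin (b * t)) (fun t => b * cos (b * t)).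
Proof.
apply: derive_primitive => [x|x].
  by apply: is_derive_scale => t; exact: is_derive_sin.
apply: cvgM; first exact: cvg_cst.
apply: continuous_comp; last exact: continuous_cos.
by apply: cvgM; [exact: cvg_cst|exact: cvg_id].
Qed.

Lemma Lfun2M (c h : R -> R) : continuous c -> (forall t, `|c t| <= 1) ->
  h \in L2r -> (fun t => c t * h t) \in L2r.
Proof.
move=> cc c1 hh; apply: (Lfun2_le (M := 1) _ hh).
  apply: measurable_funM; first exact: continuous_measurable_fun.
  exact: Lfun2_measurable.
by move=> t; rewrite normrM mul1r ler_piMl.
Qed.

Lemma norm_cos_le1 (x : R) : `|cos x| <= 1.
Proof. by rewrite ler_norml cos_geN1 cos_le1. Qed.

Lemma norm_sin_le1 (x : R) : `|sin x| <= 1.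
Proof. by rewrite ler_norml sin_geN1 sin_le1. Qed.

(* Multiplication by e^(- i Im r y) reduces to the case of a real r. *)
Lemma complex_resolvent (r : C) g : Re r != 0 -> L2_complex g ->
  exists u, H1_strong u (fun t => r * u t + g t).
Proof.
case: r => [al be] /= al0 [hg1 hg2].
pose co t := cos (be * t); pose si t := sin (be * t).
have pco : primitive co (fun t => - be * si t) := primitive_cos be.
have psi : primitive si (fun t => be * co t) := primitive_sin be.
have cco := primitive_continuous pco; have csi := primitive_continuous psi.
have lco h : h \in L2r -> (fun t => co t * h t) \in L2r.
  by apply: Lfun2M => // t; exact: norm_cos_le1.
have lsi h : h \in L2r -> (fun t => si t * h t) \in L2r.
  by apply: Lfun2M => // t; exact: norm_sin_le1.
(* The right-hand sides are the real and imaginary parts of e^(- i be t) g, and u will be e^(i be t)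
   (v1 + i v2). *)
have [v1 pv1 hv1] := real_resolvent al0 (Lfun2D (lco _ hg1) (lsi _ hg2)).
have [v2 pv2 hv2] := real_resolvent al0 (Lfun2D (lco _ hg2) (Lfun2Z (-1) (lsi _ hg1))).
exists (fun t => (co t * v1 t + - 1 * (si t * v2 t)) +i* (si t * v1 t + co t * v2 t)).
have lu : L2_complex (fun t => (co t * v1 t + - 1 * (si t * v2 t)) +i* (si t * v1 t + co t * v2 t)).
  split => /=; apply: Lfun2D; [exact: lco|apply: Lfun2Z; exact: lsi|exact: lsi|exact: lco].
have cs t : si t ^+ 2 = 1 - co t ^+ 2 by rewrite -(sin2cos2 (be * t)); rewrite /si /co; ring.
split => //.
- by apply: L2_complexD => //; exact: (L2_complexZ (al +i* be) lu).
- apply: eq_primitive (primitiveD (primitiveM pco pv1) (primitiveZ (-1) (primitiveM psi pv2))) => t /=.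
  rewrite ReD ReM/=; have := cs t; set a := co t; set b := si t => bE; ring: bE.
- apply: eq_primitive (primitiveD (primitiveM psi pv1) (primitiveM pco pv2)) => t /=.
  rewrite ImD ImM/=; have := cs t; set a := co t; set b := si t => bE; ring: bE.
Qed.

End ComplexResolvent.

(** * Surjectivity of constant coefficient systems *)

Section Surjectivity.
Context {R : realType}.
Local Notation C := R[i].
Implicit Types (u v g : R -> C) (h : nat -> R -> C) (p q : {poly C}).

Lemma H1_strong0 : H1_strong (fun _ : R => 0 : C) (fun _ : R => 0 : C).
Proof.
have L0 : (fun _ : R => 0 : R) \in Lfun (@lebesgue_measure R) 2%:E.
  have := (Lfun_addr_closed (@lebesgue_measure R) (_ : (1 <= 2%:E)%E)).1.
  by apply; rewrite lee_fin ler1n.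
have p0 : primitive (fun _ : R => 0) (fun _ : R => 0).
  by apply: derive_primitive; exact: cst_continuous.
by split.
Qed.

Lemma H1_strong_sum n (a : 'I_n -> C) (u v : 'I_n -> R -> C) :
  (forall i, H1_strong (u i) (v i)) ->
  H1_strong (fun t => \sum_(i < n) a i * u i t) (fun t => \sum_(i < n) a i * v i t).
Proof.
elim: n a u v => [|n IH] a u v H.
  by under eq_fun do rewrite big_ord0;
    under [X in H1_strong _ X]eq_fun do rewrite big_ord0; exact: H1_strong0.
under eq_fun do rewrite big_ord_recl.
under [X in H1_strong _ X]eq_fun do rewrite big_ord_recl.
exact: (H1_strongD (H1_strongZ (a ord0) (H ord0))
  (IH (fun i => a (lift ord0 i)) _ _ (fun i => H (lift ord0 i)))).
Qed.

(* p(d/dt) applied to a function whose successive derivatives are h 0, h 1, ... *)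
Definition polyD p h (t : R) := \sum_(j < size p) p`_j * h j t.

Lemma polyD_widen n p h t : (size p <= n)%N -> polyD p h t = \sum_(j < n) p`_j * h j t.
Proof.
move=> pn; rewrite /polyD (big_ord_widen n (fun j => p`_j * h j t) pn) big_mkcond/=.
by apply: eq_bigr => j _; case: ltnP => // ?; rewrite nth_default ?mul0r.
Qed.

Lemma polyD0 h t : polyD 0 h t = 0.
Proof. by rewrite /polyD size_poly0 big_ord0. Qed.

Lemma polyDD p q h t : polyD (p + q) h t = polyD p h t + polyD q h t.
Proof.
rewrite (polyD_widen _ _ (size_polyD p q)) (@polyD_widen _ p _ _ (leq_maxl _ (size q))).
rewrite (@polyD_widen _ q _ _ (leq_maxr (size p) _)) -big_split/=.
by apply: eq_bigr => j _; rewrite coefD mulrDl.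
Qed.

Lemma polyD_sum I (s : seq I) (P : pred I) (F : I -> {poly C}) h t :
  polyD (\sum_(i <- s | P i) F i) h t = \sum_(i <- s | P i) polyD (F i) h t.
Proof.
exact: (big_morph (fun p => polyD p h t) (fun p q => polyDD p q h t) (polyD0 h t)).
Qed.

Lemma polyDZ (c : C) p h t : polyD (c *: p) h t = c * polyD p h t.
Proof.
rewrite (polyD_widen _ _ (size_scale_leq c p)) mulr_sumr.
by apply: eq_bigr => j _; rewrite coefZ mulrA.
Qed.

Lemma polyDX p h t : polyD ('X * p) h t = \sum_(j < size p) p`_j * h j.+1 t.
Proof.
have sX : (size ('X * p)%R <= (size p).+1)%N.
  by rewrite (leq_trans (size_polyMleq _ _))// size_polyX.
rewrite (polyD_widen _ _ sX) big_ord_recl coefXM mul0r add0r.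
by apply: eq_bigr => j _; rewrite coefXM.
Qed.

(** Induction on the roots: solve (D - r) u = g, then Q(D) h = u for the product Q of the other
    factors. One more derivative is gained because Q is monic, so that [h n] is u minus lower
    derivatives. *)
Lemma poly_resolvent (s : seq C) g : all (fun r => complex.Re r != 0) s ->
  L2_complex g ->
  exists h, (forall j, (j < size s)%N -> H1_strong (h j) (h j.+1)) /\
    forall t, polyD (\prod_(r <- s) ('X - r%:P)) h t = g t.
Proof.
elim: s g => [|r s IH] g /=.
  move=> _ _; exists (fun _ => g); split => // t.
  by rewrite big_nil /polyD size_poly1 big_ord_recl big_ord0 coef1 mul1r addr0.
move=> /andP[r0 s0] lg; have [u Hu] := complex_resolvent r0 lg.
have [lu _ _ _] := Hu; have [h [Hh Eh]] := IH _ s0 lu.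
set n := size s in Hh *; set Q := \prod_(r <- s) _ in Eh.
have sQ : size Q = n.+1 by rewrite size_prod_XsubC.
have Qn : Q`_n = 1.
  have /monicP := monic_prod_XsubC s predT id.
  by rewrite /lead_coef -/Q sQ.
(* The derivative of [h n], read off by differentiating Q(D) h = u with u' = r u + g. *)
pose top t := r * u t + g t - \sum_(j < n) Q`_j * h j.+1 t.
have Htop : H1_strong (h n) top.
  have -> : h n = (fun t => u t + - 1 * \sum_(j < n) Q`_j * h j t).
    apply/funext => t; rewrite -Eh /polyD sQ big_ord_recr/= Qn; ring.
  have -> : top = (fun t => r * u t + g t + - 1 * \sum_(j < n) Q`_j * h j.+1 t).
    by apply/funext => t; rewrite /top mulN1r.
  apply: H1_strongD => //; apply: H1_strongZ; apply: H1_strong_sum => j.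
  exact: Hh.
(* The induction hypothesis says nothing about [h] beyond index [n], hence the replacement there. *)
pose h' j := if (j <= n)%N then h j else top.
exists h'; split => [j|t].
  rewrite ltnS leq_eqVlt /h' => /predU1P[->|jn]; first by rewrite leqnn ltnn.
  by rewrite ltnW// jn; exact: Hh.
have EQ : polyD Q h' t = u t.
  rewrite -Eh; apply: eq_bigr => j _; rewrite /h'.
  by have := ltn_ord j; rewrite {2}sQ ltnS => ->.
rewrite big_cons -/Q mulrBl polyDD -mulNr -polyCN mul_polyC polyDZ EQ polyDX sQ.
rewrite big_ord_recr/= Qn /h' ltnn.
under eq_bigr => j _ do rewrite ltn_ord.
rewrite /top; ring.
Qed.

(** Brings a(D) p(D) h to the shape of [operator_graph], in which only p(D) h and its first two
    derivatives occur. *)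
Lemma polyD_mul (a p : {poly C}) h t : (size a <= 3)%N ->
  polyD (a * p) h t =
  a`_0 * polyD p h t + a`_1 * polyD ('X * p) h t + a`_2 * polyD ('X * ('X * p)) h t.
Proof.
move=> a3; rewrite -!polyDZ -!polyDD; congr polyD.
have {1}-> : a = (a`_0)%:P + a`_1 *: 'X + a`_2 *: 'X^2.
  apply/polyP => -[|[|[|j]]]; rewrite !coefE/= ?mulr1 ?mulr0 ?addr0 ?add0r//.
  by rewrite nth_default// (leq_trans a3).
rewrite -!mul_polyC; ring.
Qed.

Lemma H1_strong_polyD p h n : (size p < n)%N ->
  (forall j, (j < n.-1)%N -> H1_strong (h j) (h j.+1)) ->
  H1_strong (polyD p h) (polyD ('X * p) h).
Proof.
case: n => // n; rewrite ltnS => pn H.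
have -> : polyD ('X * p) h = fun t => \sum_(j < size p) p`_j * h j.+1 t.
  by apply/funext => t; rewrite polyDX.
by apply: H1_strong_sum => j; apply: H; rewrite (leq_trans (ltn_ord j)).
Qed.

(* Z = adj(S)(d/dy) h where det(S)(d/dy) h = g. *)
Lemma operator_surjective (S : 'M[{poly C}]_2) (g : R -> 'cV[C]_2) :
  (forall i j, size (S i j) <= 3)%N -> size (\det S) = 5 ->
  (forall r, root (\det S) r -> complex.Re r != 0) ->
  L2 g -> exists Z, operator_graph S Z g.
Proof.
move=> sS sdet rdet lg.
have [rs Edet] := closed_field_poly_normal (\det S).
have lc0 : lead_coef (\det S) != 0.
  by rewrite lead_coef_eq0 -size_poly_eq0 sdet.
have srs : size rs = 4.
  by move: sdet; rewrite Edet size_scale// size_prod_XsubC => -[].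
have rs0 : all (fun r => complex.Re r != 0) rs.
  apply/allP => r rin; apply: rdet; rewrite Edet rootZ// root_prod_XsubC//.
have /choice[h Hh] : forall i : 'I_2, exists h : nat -> R -> C,
    (forall j, (j < 4)%N -> H1_strong (h j) (h j.+1)) /\
    forall t, polyD (\det S) h t = g t i 0.
  move=> i; have := poly_resolvent rs0 (L2_complexZ (lead_coef (\det S))^-1 (lg i)).
  rewrite srs => -[h [Hh Eh]]; exists h; split => // t.
  by rewrite {1}Edet polyDZ Eh mulrA mulfV ?mul1r.
(* In dimension 2 an entry of the adjugate is an entry of [S] up to sign. *)
have sadj i j : (size (\adj S i j) <= 3)%N.
  rewrite mxE /cofactor; set M := row' _ _.
  have -> : \det M = M 0 0 by rewrite {1}[M]mx11_scalar det_scalar1.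
  rewrite /M !mxE -signr_odd; case: (odd _).
    by rewrite expr1 mulN1r size_polyN.
  by rewrite expr0 mul1r.
(* [Y m] is m(D) Z, so that m = 1, X, X^2 yield Z and its two derivatives. For m of degree at most
   1, m adj(S) has degree at most 3, and the four controlled derivatives of [h] suffice to
   differentiate [Y m]. *)
pose Y (m : {poly C}) (t : R) : 'cV[C]_2 :=
  \col_j \sum_k polyD (m * \adj S j k) (h k) t.
have HY (m : {poly C}) : (size m <= 2)%N -> H1_derivative (Y m) (Y ('X * m)).
  move=> m2 j; apply: H1_strong_derivative.
  have -> : (fun y => Y m y j 0) = fun t => \sum_(k < 2) 1 * polyD (m * \adj S j k) (h k) t.
    by apply/funext => t; rewrite mxE; apply: eq_bigr => k _; rewrite mul1r.
  have -> : (fun y => Y ('X * m) y j 0) =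
      fun t => \sum_(k < 2) 1 * polyD ('X * (m * \adj S j k)) (h k) t.
    by apply/funext => t; rewrite mxE; apply: eq_bigr => k _; rewrite mul1r mulrA.
  apply: (H1_strong_sum (fun=> 1)) => k; apply: (@H1_strong_polyD _ _ 5) => [|j4 j44].
    rewrite (leq_ltn_trans (size_polyMleq _ _))//.
    by have := sadj j k; move: (size _) m2 => a; case: a => [|[|[|a]]]//; case: (size _) => [|[|[|[|b]]]].
  exact: (Hh k).1.
exists (Y 1), (Y ('X * 1)), (Y ('X * ('X * 1))); split.
- by apply: HY; rewrite size_poly1.
- by apply: HY; rewrite mulr1 size_polyX.
apply: aeW => t; apply/colP => i; rewrite !mxE -!big_split/=.
transitivity (\sum_j \sum_k polyD (S i j * \adj S j k) (h k) t).
  rewrite exchange_big/=.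
  have -> : \sum_k \sum_j polyD (S i j * \adj S j k) (h k) t =
    \sum_k polyD ((S *m \adj S) i k) (h k) t.
    by apply: eq_bigr => k _; rewrite mxE polyD_sum.
  rewrite mul_mx_adj (bigD1 i)//= big1 => [|k ki]; last first.
    by rewrite mxE eq_sym (negPf ki) mulr0n polyD0.
  by rewrite addr0 mxE eqxx mulr1n (Hh i).2.
apply: eq_bigr => j _; rewrite !mxE/= !mulr_sumr -!big_split/=.
by apply: eq_bigr => k _; rewrite polyD_mul// !mulr1 mul1r mulrA.
Qed.

End Surjectivity.

(** * Energy estimate *)

Section EnergyAlgebra.
Context {R : realType}.
Local Notation C := R[i].
Local Notation Re := complex.Re.
Local Notation Im := complex.Im.

(** Re (x conj y), the Euclidean inner product of the plane. *)
Definition dotC (x y : C) : R := Re x * Re y + Im x * Im y.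

Lemma dotC_ge0 (x : C) : 0 <= dotC x x.
Proof. by rewrite /dotC addr_ge0// -expr2 sqr_ge0. Qed.

Lemma dotC_eq0 (x : C) : dotC x x = 0 -> x = 0.
Proof.
rewrite /dotC -!expr2 => /eqP; rewrite paddr_eq0 ?sqr_ge0// !sqrf_eq0.
by move=> /andP[/eqP ? /eqP ?]; exact: eqC.
Qed.

(* Stands for the derivative of dotC u v, with u', v' those of u, v. *)
Definition ddotC (u u' v v' : C) : R := dotC u' v + dotC u v'.

(* With T' = l - (c + s) D, D = d/dy and W = T' z, the system reads
     T' W1 + 2 s D W1 - (1 - s^2) D^2 z1 + 2 b z1 - 2 w W2 + 2 (k - w s) D z2 = g1
     T' W2 + 2 s D W2 - (1 - s^2) D^2 z2 + 2 w W1 - 2 (k - w s) D z1 = g2,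
   and pairing it with W gives Re l times a positive definite form if s is well
   chosen, up to the derivative of a flux. *)
Context (l : C) (b k w c s : R).
Let al := Re l.
Let tau := c + s.
Let kap := 2 * (k - w * s).

Definition Wsym (z z' : C) := l * z + - tau%:C * z'.

Definition g1sym (z1 z2 z1' z2' z1'' z2'' : C) :=
  (l ^+ 2 + (2 * b)%:C) * z1 - (2 * c)%:C * l * z1' - (1 - c ^+ 2)%:C * z1''
  - (2 * w)%:C * l * z2 + (2 * (c * w + k))%:C * z2'.

Definition g2sym (z1 z2 z1' z2' z1'' z2'' : C) :=
  l ^+ 2 * z2 - (2 * c)%:C * l * z2' - (1 - c ^+ 2)%:C * z2''
  + (2 * w)%:C * l * z1 - (2 * (c * w + k))%:C * z1'.

Definition dflux (z1 z2 z1' z2' z1'' z2'' : C) :=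
  let W1 := Wsym z1 z1' in let W1' := Wsym z1' z1'' in
  let W2 := Wsym z2 z2' in let W2' := Wsym z2' z2'' in
  (s - tau / 2) * (ddotC W1 W1' W1 W1' + ddotC W2 W2' W2 W2') +
  - (1 - s ^+ 2) * (ddotC z1' z1'' W1 W1' + ddotC z2' z2'' W2 W2') +
  - ((1 - s ^+ 2) * tau / 2) * (ddotC z1' z1'' z1' z1'' + ddotC z2' z2'' z2' z2'') +
  - kap * ddotC z1 z1' (l * z2) (l * z2') +
  - (b * tau) * ddotC z1 z1' z1 z1'.

Definition dflux' (z1 z2 z1' z2' z1'' z2'' : C) :=
  2 * al * dflux z1 z2 z1' z2' z1'' z2'' +
  - (al ^+ 3 * tau) * (ddotC z1 z1' z1 z1' + ddotC z2 z2' z2 z2').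

Lemma energy_identity (z1 z2 z1' z2' z1'' z2'' : C) :
  dotC (g1sym z1 z2 z1' z2' z1'' z2'') (Wsym z1 z1') +
  dotC (g2sym z1 z2 z1' z2' z1'' z2'') (Wsym z2 z2') =
  al * (dotC (Wsym z1 z1') (Wsym z1 z1') + dotC (Wsym z2 z2') (Wsym z2 z2') +
    (1 - s ^+ 2) * (dotC z1' z1' + dotC z2' z2') + 2 * b * dotC z1 z1 +
    2 * kap * dotC z2' z1) + dflux z1 z2 z1' z2' z1'' z2''.
Proof.
rewrite /dflux /g1sym /g2sym /Wsym /ddotC /dotC /al /tau /kap [l ^+ 2]expr2.
case: l z1 z2 z1' z2' z1'' z2'' => [la lb] [a1 b1] [a2 b2] [p1 q1] [p2 q2] [r1 s1] [r2 s2] /=.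
by field.
Qed.

(** Expanding |g - al W|^2 >= 0 with the energy identity bounds al^2 |W|^2 by |g|^2, and expanding
    |W - al z|^2 >= 0 bounds al^2 |z|^2 by |W|^2, both up to derivatives; the second one produces
    the last term of [dflux']. *)
Lemma energy_inequality (z1 z2 z1' z2' z1'' z2'' : C) :
  0 < 1 - s ^+ 2 -> 0 <= b -> kap ^+ 2 <= 2 * b * (1 - s ^+ 2) ->
  al ^+ 4 * (dotC z1 z1 + dotC z2 z2) + dflux' z1 z2 z1' z2' z1'' z2'' <=
  dotC (g1sym z1 z2 z1' z2' z1'' z2'') (g1sym z1 z2 z1' z2' z1'' z2'') +
  dotC (g2sym z1 z2 z1' z2' z1'' z2'') (g2sym z1 z2 z1' z2' z1'' z2'').
Proof.
move=> m0 b0 kb; have := energy_identity z1 z2 z1' z2' z1'' z2''.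
rewrite /dflux'; set g1 := g1sym _ _ _ _ _ _; set g2 := g2sym _ _ _ _ _ _; set F := dflux _ _ _ _ _ _.
set W1 := Wsym z1 z1'; set W2 := Wsym z2 z2'.
move=> E; clearbody g1 g2 F.
(* The cross term is absorbed by completing the square in [z2']; the hypothesis on [kap] is the
   discriminant condition. *)
have Q : 0 <= (1 - s ^+ 2) * (dotC z1' z1' + dotC z2' z2') + 2 * b * dotC z1 z1 +
    2 * kap * dotC z2' z1.
  have -> : (1 - s ^+ 2) * (dotC z1' z1' + dotC z2' z2') + 2 * b * dotC z1 z1 +
     2 * kap * dotC z2' z1 = (1 - s ^+ 2) * dotC z1' z1' + (1 - s ^+ 2)^-1 * (
     (((1 - s ^+ 2) * Re z2' + kap * Re z1) ^+ 2 + ((1 - s ^+ 2) * Im z2' + kap * Im z1) ^+ 2) +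
      (2 * b * (1 - s ^+ 2) - kap ^+ 2) * dotC z1 z1).
    by rewrite /dotC; field; rewrite gt_eqF.
  apply: addr_ge0; first by rewrite mulr_ge0 ?dotC_ge0// ltW.
  rewrite mulr_ge0// ?invr_ge0 ?(ltW m0)//.
  by rewrite addr_ge0 ?addr_ge0 ?sqr_ge0// mulr_ge0 ?dotC_ge0// subr_ge0.
have dg (x y : C) : 2 * al * dotC x y - al ^+ 2 * dotC y y <= dotC x x.
  rewrite -subr_ge0.
  have -> : dotC x x - (2 * al * dotC x y - al ^+ 2 * dotC y y) =
    (Re x - al * Re y) ^+ 2 + (Im x - al * Im y) ^+ 2 by rewrite /dotC; ring.
  by rewrite addr_ge0 ?sqr_ge0.
have Wz (z z' : C) : dotC (Wsym z z') z = al * dotC z z - tau / 2 * ddotC z z' z z'.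
  rewrite /Wsym /ddotC /dotC /al; case: l z z' => [la lb] [a1 b1] [p1 q1] /=.
  by field.
have h1 := dg g1 W1; have h2 := dg g2 W2.
have h3 := dg W1 z1; have h4 := dg W2 z2.
rewrite Wz in h3; rewrite Wz in h4.
rewrite -subr_ge0 in h3; rewrite -subr_ge0 in h4.
have h5 := mulr_ge0 (sqr_ge0 al) h3; have h6 := mulr_ge0 (sqr_ge0 al) h4.
have h7 := mulr_ge0 (sqr_ge0 al) Q.
have h8 := congr1 (fun x => 2 * al * x) E.
rewrite /= in h8; clear E Q h3 h4 dg Wz.
lra.
Qed.

End EnergyAlgebra.

(** * The energy inequality integrated over the line *)

Section EnergyEstimate.
Context {R : realType}.
Local Notation C := R[i].
Local Notation mu := (@lebesgue_measure R).
Implicit Types (Z g : R -> 'cV[C]_2).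

Definition sqnorm (x : 'cV[C]_2) : R := dotC (x 0 0) (x 0 0) + dotC (x 1 0) (x 1 0).

Lemma sqnorm_ge0 x : 0 <= sqnorm x.
Proof. by rewrite addr_ge0 ?dotC_ge0. Qed.

Lemma L2_normE Z : L2_norm Z = ((\int[mu]_y (sqnorm (Z y))%:E) `^ 2^-1)%E.
Proof.
rewrite /L2_norm unlock/=; congr (_ `^ _)%E; apply: eq_integral => y _.
congr EFin; rewrite big_ord_recl big_ord_recl big_ord0 addr0.
have -> : lift ord0 ord0 = 1 :> 'I_2 by apply: val_inj.
rewrite powR_mulrn// ger0_norm ?sqrtr_ge0// sqr_sqrtr; first by rewrite /sqnorm /dotC !expr2.
by rewrite !addr_ge0 ?sqr_ge0.
Qed.

Lemma L2_norm_le Z g (M : R) : 0 <= M ->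
  (\int[mu]_y (sqnorm (Z y))%:E <= (M ^+ 2)%:E * \int[mu]_y (sqnorm (g y))%:E)%E ->
  (L2_norm Z <= M%:E * L2_norm g)%E.
Proof.
move=> M0 le; rewrite !L2_normE.
have g0 : (0 <= \int[mu]_y (sqnorm (g y))%:E)%E.
  by apply: integral_ge0 => y _; rewrite lee_fin sqnorm_ge0.
have -> : M%:E = ((M ^+ 2)%:E `^ 2^-1)%E.
  by rewrite poweR_EFin -powR_mulrn// -powRrM mulfV// powRr1.
rewrite -poweRM// ?lee_fin ?sqr_ge0//; apply: gt0_ler_poweR => //.
- by rewrite in_itv/= leey andbT integral_ge0// => y _; rewrite lee_fin sqnorm_ge0.
- by rewrite in_itv/= leey andbT mule_ge0// lee_fin sqr_ge0.
Qed.

Lemma sqnorm_integrable Z : L2 Z -> mu.-integrable setT (EFin \o (fun y => sqnorm (Z y))).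
Proof.
move=> lZ; have [r0 i0] := lZ 0; have [r1 i1] := lZ 1.
apply: (eq_integrable _ _ _ _ (integrableD _
  (integrableD _ (Lfun2_integrable_sqr r0) (Lfun2_integrable_sqr i0))
  (integrableD _ (Lfun2_integrable_sqr r1) (Lfun2_integrable_sqr i1)))) => //.
Qed.

Definition flux (Phi phi : R -> R) := primitive Phi phi /\ mu.-integrable setT (EFin \o Phi).

Lemma fluxD Phi phi Psi psi : flux Phi phi -> flux Psi psi ->
  flux (fun t => Phi t + Psi t) (fun t => phi t + psi t).
Proof.
move=> [p i] [q j]; split; first exact: primitiveD.
by apply: (eq_integrable _ _ _ _ (integrableD _ i j)).
Qed.

Lemma fluxZ (a : R) Phi phi : flux Phi phi -> flux (fun t => a * Phi t) (fun t => a * phi t).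
Proof.
move=> [p i]; split; first exact: primitiveZ.
by apply: (eq_integrable _ _ _ _ (integrableZl _ a i)).
Qed.

Lemma flux_dotC (u u' v v' : R -> C) : H1_strong u u' -> H1_strong v v' ->
  flux (fun t => dotC (u t) (v t)) (fun t => ddotC (u t) (u' t) (v t) (v' t)).
Proof.
move=> [[ru iu] _ pru piu] [[rv iv] _ prv piv]; split.
  apply: eq_primitive (primitiveD (primitiveM pru prv) (primitiveM piu piv)) => t.
  by rewrite /ddotC /dotC; ring.
apply: (eq_integrable _ _ _ _
  (integrableD _ (Lfun2_mul_integrable ru rv) (Lfun2_mul_integrable iu iv))) => //.
Qed.

Lemma P_symbol_apply (f : R -> R) (a k w c : R) (l : C) (x y z : 'cV[C]_2) :
  let P := P_symbol f a k w c l in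
  let b := a ^+ 2 * derive1 f (a ^+ 2) in
  let v := map_mx (coefp 0) P *m x + map_mx (coefp 1) P *m y + map_mx (coefp 2) P *m z in
  v 0 0 = g1sym l b k w c (x 0 0) (x 1 0) (y 0 0) (y 1 0) (z 0 0) (z 1 0) /\
  v 1 0 = g2sym l k w c (x 0 0) (x 1 0) (y 0 0) (y 1 0) (z 0 0) (z 1 0).
Proof.
move=> P b v; rewrite /v !mxE !big_ord_recl !big_ord0.
have -> : lift ord0 ord0 = 1 :> 'I_2 by apply: val_inj.
rewrite /P /P_symbol /J_symbol /H_symbol /mx22 !mxE /=.
rewrite -!polyCN !(mulr1n, mulr0n) !mul_polyC !coefE/=.
rewrite /g1sym /g2sym.
have -> : ord0 = 0 :> 'I_2 by [].
have -> : 2 * a ^+ 2 * derive1 f (a ^+ 2) = 2 * b by rewrite /b mulrA.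
by split; ring.
Qed.

(** The flux is a combination of products of L^2 functions, hence integrable, and drops out of the
    integrated [energy_inequality]. *)
Lemma energy_estimate (f : R -> R) (a k w c s : R) (l : C) Z g :
  let b := a ^+ 2 * derive1 f (a ^+ 2) in
  0 < 1 - s ^+ 2 -> 0 <= b -> (2 * (k - w * s)) ^+ 2 <= 2 * b * (1 - s ^+ 2) ->
  complex.Re l != 0 ->
  L2 g -> operator_graph (P_symbol f a k w c l) Z g ->
  (L2_norm Z <= ((complex.Re l ^+ 2)^-1)%:E * L2_norm g)%E.
Proof.
move=> b m0 b0 kb l0 lg [Z1 [Z2 [HZ HZ1 Hg]]].
(* [Z2] is kept as it is; it fixes the representative z' of [Z1], which in turn fixes z. *)
have rep i : exists z z', [/\ {ae mu, forall t, Z t i 0 = z t},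
   {ae mu, forall t, Z1 t i 0 = z' t}, H1_strong z z' & H1_strong z' (fun t => Z2 t i 0)].
  have [_ lZ2 _] := HZ1 i.
  have [z' e' h'] := H1_derivative_strong (HZ1 i) lZ2 (aeW _ (fun=> erefl)).
  have [lz' _ _ _] := h'.
  have [z e h] := H1_derivative_strong (HZ i) lz' e'.
  by exists z, z'.
have [z1 [z1' [e1 e1' h1 h1']]] := rep 0; have [z2 [z2' [e2 e2' h2 h2']]] := rep 1.
set z1'' := (fun t => _) in h1'; set z2'' := (fun t => _) in h2'.
pose tau := c + s; pose al := complex.Re l.
have hW1 := H1_strongD (H1_strongZ l h1) (H1_strongZ (- tau%:C) h1').
have hW2 := H1_strongD (H1_strongZ l h2) (H1_strongZ (- tau%:C) h2').
have := fluxD (fluxZ (2 * al) (fluxD (fluxD (fluxD (fluxD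
   (fluxZ (s - tau / 2) (fluxD (flux_dotC hW1 hW1) (flux_dotC hW2 hW2)))
   (fluxZ (- (1 - s ^+ 2)) (fluxD (flux_dotC h1' hW1) (flux_dotC h2' hW2))))
   (fluxZ (- ((1 - s ^+ 2) * tau / 2)) (fluxD (flux_dotC h1' h1') (flux_dotC h2' h2'))))
   (fluxZ (- (2 * (k - w * s))) (flux_dotC h1 (H1_strongZ l h2))))
   (fluxZ (- (b * tau)) (flux_dotC h1 h1))))
  (fluxZ (- (al ^+ 3 * tau)) (fluxD (flux_dotC h1 h1) (flux_dotC h2 h2))).
set Phi := (X in flux X) => hP.
have {}hP : flux Phi (fun t => dflux' l b k w c s (z1 t) (z2 t) (z1' t) (z2' t) (z1'' t) (z2'' t)).
  exact: hP.
have [pP iP] := hP.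
have mdot (u u' : R -> C) : H1_strong u u' -> measurable_fun setT (fun t => dotC (u t) (u t)).
  by move=> [[/Lfun2_measurable r /Lfun2_measurable i] _ _ _];
    apply: measurable_funD; exact: measurable_funM.
pose F t := al ^+ 4 * (dotC (z1 t) (z1 t) + dotC (z2 t) (z2 t)).
have mzz : measurable_fun setT (fun t => dotC (z1 t) (z1 t) + dotC (z2 t) (z2 t)).
  by apply: measurable_funD; [exact: mdot h1|exact: mdot h2].
have mF : measurable_fun setT F by exact: measurable_funM.
have le := integral_le_integrable_flux mF _ _ (sqnorm_integrable lg) pP iP _.
have {}le : (\int[mu]_t (F t)%:E <= \int[mu]_t (sqnorm (g t))%:E)%E.
  apply: le.
  - by move=> t; apply: mulr_ge0; [exact: exprn_even_ge0|rewrite addr_ge0 ?dotC_ge0].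
  - by move=> t; exact: sqnorm_ge0.
  - have := ae_and (ae_and (ae_and e1 e1') (ae_and e2 e2')) Hg.
    apply: ae_imply => t [[[E1 E1'] [E2 E2']] Eg].
    have := energy_inequality l c (z1 t) (z2 t) (z1' t) (z2' t) (z1'' t) (z2'' t) m0 b0 kb.
    have [G1 G2] := P_symbol_apply f a k w c l (Z t) (Z1 t) (Z2 t).
    by rewrite /sqnorm Eg G1 G2 E1 E1' E2 E2'.
apply: L2_norm_le; first by rewrite invr_ge0 sqr_ge0.
have al4 : 0 < al ^+ 4 by rewrite exprn_even_gt0.
have -> : ((complex.Re l ^+ 2)^-1) ^+ 2 = (al ^+ 4)^-1 by rewrite exprVn -exprM.
have -> : (\int[mu]_y (sqnorm (Z y))%:E =
    \int[mu]_t (dotC (z1 t) (z1 t) + dotC (z2 t) (z2 t))%R%:E)%E.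
  have [[r0 i0] _ _ _] := h1; have [[r1 i1] _ _ _] := h2.
  apply: ae_eq_integral => //.
  - have lZ : L2 Z by move=> i; have [] := HZ i.
    exact: measurable_int (sqnorm_integrable lZ).
  - exact/measurable_EFinP.
  - by apply: ae_imply (ae_and e1 e2) => t [E1 E2] _; rewrite /sqnorm E1 E2.
rewrite -(@lee_pmul2l _ (al ^+ 4)%:E)// muleA -EFinM mulfV ?gt_eqF// mul1e.
apply: le_trans le; rewrite -ge0_integralZl//; last 2 first.
- by move=> t _; rewrite lee_fin addr_ge0 ?dotC_ge0.
- by rewrite lee_fin ltW.
exact/measurable_EFinP.
Qed.

End EnergyEstimate.

(** * Invertibility *)

Section Invertibility.
Context {R : realType}.
Local Notation C := R[i].
Local Notation mu := (@lebesgue_measure R).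
Implicit Types (Z g : R -> 'cV[C]_2).

Lemma ord2_cases (i : 'I_2) : i = 0 \/ i = 1.
Proof. by case: i => [[|[|]]]// ?; [left|right]; apply: val_inj. Qed.

Lemma sqnorm_eq0 (x : 'cV[C]_2) : sqnorm x = 0 -> x = 0.
Proof.
move=> /eqP; rewrite paddr_eq0 ?dotC_ge0// => /andP[/eqP x0 /eqP x1].
by apply/colP => i; rewrite mxE; case: (ord2_cases i) => ->; exact: dotC_eq0.
Qed.

Lemma L2_zero : L2 (fun _ : R => 0 : 'cV[C]_2).
Proof.
move=> i; have [h _ _ _] := @H1_strong0 R.
by have -> : (fun y : R => (0 : 'cV[C]_2) i 0) = fun=> 0 by apply/funext => y; rewrite mxE.
Qed.

Lemma L2_norm_zero : L2_norm (fun _ : R => 0 : 'cV[C]_2) = 0%E.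
Proof.
rewrite L2_normE integral0_eq ?poweR0r// ?invr_neq0// => y _.
by rewrite /sqnorm /dotC !mxE/= !mulr0 !addr0.
Qed.

Lemma L2_norm_eq0 Z : L2 Z -> L2_norm Z = 0%E -> {ae mu, forall y, Z y = 0}.
Proof.
move=> lZ; rewrite L2_normE => /poweR_eq0_eq0 E.
have /integrableP[mZ _] := sqnorm_integrable lZ.
have : (\int[mu]_y `|(EFin \o (fun y => sqnorm (Z y))) y| = 0)%E.
  rewrite -[RHS]E; last by apply: integral_ge0 => y _; rewrite lee_fin sqnorm_ge0.
  by apply: eq_integral => y _ /=; rewrite ger0_norm ?sqnorm_ge0.
move=> /(ae_eq_integral_abs mu measurableT mZ); apply: ae_imply => y /(_ I) /= [] /sqnorm_eq0//.
Qed.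

Lemma eval_kernel (S : 'M[{poly C}]_2) (r : C) : root (\det S) r ->
  exists2 v : 'cV[C]_2, v != 0 & map_mx (horner_eval r) S *m v = 0.
Proof.
move=> /rootP det0; have : \det (map_mx (horner_eval r) S)^T == 0.
  by rewrite det_tr det_map_mx/= horner_evalE det0.
move=> /det0P[v v0 vS]; exists v^T; first by rewrite trmx_eq0.
by apply: trmx_inj; rewrite trmx_mul trmxK vS trmx0.
Qed.

(** S(r) v in the shape of [operator_graph], as for the exponential e^(r y) v with derivatives r v
    and r^2 v at y = 0. *)
Lemma eval_deg2 (S : 'M[{poly C}]_2) (r : C) (v : 'cV[C]_2) :
  (forall i j, size (S i j) <= 3)%N ->
  map_mx (horner_eval r) S *m v = map_mx (coefp 0) S *m v +
    map_mx (coefp 1) S *m (r *: v) + map_mx (coefp 2) S *m (r ^+ 2 *: v).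
Proof.
move=> sS; rewrite -!scalemxAr !scalemxAl -!mulmxDl; congr (_ *m _).
apply/matrixP => i j; rewrite !mxE /= horner_evalE (horner_coef_wide r (sS i j)).
by rewrite !big_ord_recl big_ord0 /= expr0 mulr1 addr0 expr1 addrA [r * _]mulrC [r ^+ 2 * _]mulrC.
Qed.

Lemma det_mx2 (T : comNzRingType) (S : 'M[T]_2) :
  \det S = S 0 0 * S 1 1 - S 0 1 * S 1 0.
Proof.
rewrite (expand_det_row _ 0) !big_ord_recl big_ord0 addr0.
rewrite /cofactor; set M := row' _ _; set N := row' _ _.
rewrite [M]mx11_scalar [N]mx11_scalar !det_scalar1 !mxE /=.
have -> : lift ord0 ord0 = 1 :> 'I_2 by apply: val_inj.
have -> : lift 1 0 = 0 :> 'I_2 by apply: val_inj.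
by rewrite expr0 expr1 mul1r mulN1r mulrN.
Qed.

Lemma size_P_symbol (f : R -> R) (a k w c : R) (l : C) i j :
  (size (P_symbol f a k w c l i j) <= 3)%N.
Proof.
apply/leq_sizeP => m; case: m => [|[|[|m]]]// _.
rewrite /P_symbol /J_symbol /H_symbol /mx22 !mxE.
rewrite -!polyCN !mul_polyC.
by case: (ord2_cases i) => ->; case: (ord2_cases j) => -> /=;
  rewrite ?mulr1n ?mulr0n !coefE/= ?(mulr0, addr0, mul0r, add0r).
Qed.

(** Only the diagonal entries have degree 2, so the coefficient of D^4 is (1 - c^2)^2; here c must
    differ from 1 and -1. *)
Lemma size_det_P_symbol (f : R -> R) (a k w c : R) (l : C) : c != 1 -> c != -1 ->
  size (\det (P_symbol f a k w c l)) = 5.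
Proof.
move=> c1 cN1; have c2 : ((1 - c ^+ 2)%:C : C) != 0.
  rewrite -(rmorph0 (real_complex R)) (inj_eq (@complexI R)) subr_eq0 eq_sym.
  by rewrite sqrf_eq1 negb_or c1.
set S := P_symbol _ _ _ _ _ _.
have sS i j : (size (S i j) <= 3)%N by exact: size_P_symbol.
have detE := det_mx2 S.
have le5 : (size (\det S) <= 5)%N.
  rewrite detE (leq_trans (size_polyD _ _))// geq_max size_polyN.
  have prod i j i' j' : (size (S i j * S i' j')%R <= 5)%N.
    rewrite (leq_trans (size_polyMleq _ _))//.
    by have := sS i j; have := sS i' j'; case: (size _) => [|[|[|[]]]]//; case: (size _) => [|[|[|[]]]].
  by rewrite !prod.
apply/eqP; rewrite eqn_leq le5 /= ltnNge; apply/negP => /leq_sizeP /(_ 4%N (leqnn _)).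
have z3 i j m : (3 <= m)%N -> (S i j)`_m = 0.
  by move=> ?; rewrite nth_default// (leq_trans (sS i j)).
have top i j i' j' : (S i j * S i' j')`_4 = (S i j)`_2 * (S i' j')`_2.
  rewrite coefM (bigD1 (Ordinal (isT : 2 < 5)%N))//= big1 ?addr0// => m.
  rewrite -val_eqE/= => m2; case: (ltnP 2 m) => h; first by rewrite z3 ?mul0r.
  by rewrite [X in _ * X]z3 ?mulr0//; move: h m2; case: (nat_of_ord m) => [|[|[|]]].
rewrite detE coefB !top /S /P_symbol /J_symbol /H_symbol /mx22 !mxE /=.
rewrite -!polyCN !mul_polyC ?mulr1n ?mulr0n !coefE/= ?(mulr0, mul0r, addr0, add0r, subr0, mulr1).
by move=> /eqP; rewrite mulf_eq0 oppr_eq0 orbb (negPf c2).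
Qed.

(** For imaginary r, e^(r y) has constant modulus, so inner products of modes e^(r y) u and e^(r y)
    v have zero derivative. *)
Lemma ddotC_im (r u v : C) : complex.Re r = 0 -> ddotC u (r * u) v (r * v) = 0.
Proof.
rewrite /ddotC /dotC; case: r u v => [ra rb] [u1 u2] [v1 v2] /= ->; ring.
Qed.

(** A kernel vector v at an imaginary root makes both the flux term and the right-hand side of
    [energy_inequality] vanish, leaving (Re l)^4 |v|^2 <= 0. *)
Lemma P_symbol_root (f : R -> R) (a k w c s : R) (l r : C) :
  let b := a ^+ 2 * derive1 f (a ^+ 2) in
  0 < 1 - s ^+ 2 -> 0 <= b -> (2 * (k - w * s)) ^+ 2 <= 2 * b * (1 - s ^+ 2) ->
  complex.Re l != 0 -> root (\det (P_symbol f a k w c l)) r -> complex.Re r != 0.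
Proof.
move=> b m0 b0 kb l0 /eval_kernel[v v0 Ev]; apply/negP => /eqP r0.
rewrite eval_deg2 in Ev; last exact: size_P_symbol.
have [G1 G2] := P_symbol_apply f a k w c l v (r *: v) (r ^+ 2 *: v).
have := energy_inequality l c (v 0 0) (v 1 0) (r * v 0 0) (r * v 1 0)
  (r * (r * v 0 0)) (r * (r * v 1 0)) m0 b0 kb.
rewrite Ev !mxE in G1 G2; rewrite !mulrA -!expr2 -G1 -G2.
have -> : dflux' l b k w c s (v 0 0) (v 1 0) (r * v 0 0) (r * v 1 0)
  (r ^+ 2 * v 0 0) (r ^+ 2 * v 1 0) = 0.
  have W z : Wsym l c s (r * z) (r ^+ 2 * z) = r * Wsym l c s z (r * z).
    by rewrite /Wsym; ring.
  rewrite /dflux' /dflux !W [r ^+ 2]expr2 -![r * r * _]mulrA.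
  by rewrite [l * (r * _)]mulrCA !ddotC_im// !(mulr0, addr0).
rewrite addr0 {3 4}/dotC /= !mulr0 !addr0 => le0.
have al4 : 0 < complex.Re l ^+ 4 by rewrite exprn_even_gt0.
have : sqnorm v <= 0 by move: le0; rewrite pmulr_rle0.
move=> le; move/eqP: v0; apply; apply: sqnorm_eq0.
by apply/eqP; rewrite eq_le le sqnorm_ge0.
Qed.

Lemma P_symbol_invertible (f : R -> R) (a k w c s : R) (l : C) :
  let b := a ^+ 2 * derive1 f (a ^+ 2) in
  0 < 1 - s ^+ 2 -> 0 <= b -> (2 * (k - w * s)) ^+ 2 <= 2 * b * (1 - s ^+ 2) ->
  c != 1 -> c != -1 ->
  complex.Re l != 0 -> operator_invertible (P_symbol f a k w c l).
Proof.
move=> b m0 b0 kb c1 cN1 l0; split.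
- move=> Z HZ; have := energy_estimate m0 b0 kb l0 L2_zero HZ.
  rewrite L2_norm_zero mule0 => le; apply: L2_norm_eq0.
    by case: HZ => Z1 [Z2 [H _ _]] i; have [] := H i.
  by apply/eqP; rewrite eq_le le Lnorm_ge0.
- move=> g lg; apply: operator_surjective => //.
  + by move=> i j; exact: size_P_symbol.
  + exact: size_det_P_symbol.
  + by move=> r; apply: (P_symbol_root m0 b0 kb l0).
- by exists ((complex.Re l ^+ 2)^-1) => Z g lg HZ; exact: (energy_estimate m0 b0 kb l0 lg HZ).
Qed.
End Invertibility.

(** * Approximate eigenfunctions *)

Section WeylSequence.
Context {R : realType}.
Local Notation C := R[i].
Local Notation mu := (@lebesgue_measure R).
Local Notation L2r := (Lfun mu 2%:E).

(** A slowly varying cutoff and its first two derivatives, the latter in the form in which the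
    product rule delivers them. *)
Definition bump0 (e t : R) : R := (oneDsqr (e * t))^-1.
Definition bump1 (e t : R) : R := - 2 * e * ((e * t) * (bump0 e t * bump0 e t)).
Definition bump2 (e t : R) : R := - 2 * e * (e * (bump0 e t * bump0 e t) +
  (e * t) * (bump1 e t * bump0 e t + bump0 e t * bump1 e t)).

Lemma oneDsqr_gt0 (x : R) : 0 < oneDsqr x.
Proof. exact: lt_le_trans ltr01 (oneDsqr_ge1 x). Qed.

Lemma bump0_gt0 e t : 0 < bump0 e t.
Proof. by rewrite invr_gt0 oneDsqr_gt0. Qed.

Lemma bump0_eq e t : bump0 e t * (1 + (e * t) ^+ 2) = 1.
Proof. by rewrite mulVf// gt_eqF// oneDsqr_gt0. Qed.

(** With X = e t this is 2 |X| <= 1 + X^2. *)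
Lemma bump1_le e t : 0 <= e -> `|bump1 e t| <= e * `|bump0 e t|.
Proof.
move=> e0; have h := bump0_gt0 e t; have E := bump0_eq e t.
rewrite (gtr0_norm h) /bump1; set p := bump0 e t in h E *; set X := e * t in E *.
rewrite (_ : - 2 * e * (X * (p * p)) = (e * p) * (- 2 * X * p)); last by ring.
rewrite normrM ger0_norm ?mulr_ge0 ?(ltW h)// ler_piMr ?mulr_ge0 ?(ltW h)//.
have h1 := mulr_ge0 (ltW h) (sqr_ge0 (X - 1)).
have h2 := mulr_ge0 (ltW h) (sqr_ge0 (X + 1)).
by rewrite ler_norml; apply/andP; split; lra.
Qed.

Lemma bump2_le e t : 0 <= e -> `|bump2 e t| <= 8 * e ^+ 2 * `|bump0 e t|.
Proof.
move=> e0; have h := bump0_gt0 e t; have E := bump0_eq e t.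
rewrite (gtr0_norm h) /bump2 /bump1; set p := bump0 e t in h E *; set X := e * t in E *.
rewrite (_ : - 2 * e * _ = (e ^+ 2 * p) * (- 2 * p + 8 * (X ^+ 2 * p) * p)); last by ring.
rewrite normrM ger0_norm ?mulr_ge0 ?sqr_ge0 ?(ltW h)//.
rewrite (_ : 8 * e ^+ 2 * p = (e ^+ 2 * p) * 8); last by ring.
rewrite ler_wpM2l ?mulr_ge0 ?sqr_ge0 ?(ltW h)//.
have q0 : 0 <= X ^+ 2 * p by rewrite mulr_ge0 ?sqr_ge0// ltW.
(* Eliminating X leaves p (6 - 8 p) with 0 < p <= 1, to be bounded by 8. *)
have E' : X ^+ 2 * p = 1 - p by rewrite -[1]E; ring.
rewrite E' in q0 *.
by rewrite ler_norml; apply/andP; split; nra.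
Qed.

Lemma bump0_primitive e : primitive (bump0 e) (bump1 e).
Proof.
have dV (x : R) : is_derive x (1 : R) (fun t => (oneDsqr t)^-1) (- 2 * x * (oneDsqr x)^-1 ^+ 2).
  have d1 : is_derive x (1 : R) oneDsqr (2 * x).
    have h := is_deriveD (is_derive_cst (1 : R) x 1)
      (is_deriveM (is_derive_id x 1) (is_derive_id x 1)).
    have -> : 2 * x = 0 + (x *: 1 + x *: 1) by rewrite /GRing.scale/=; ring.
    exact: h.
  have ne : oneDsqr x != 0 by rewrite gt_eqF// oneDsqr_gt0.
  have := is_deriveV ne d1; rewrite /GRing.scale/= => h.
  by apply: is_derive_eq h _; rewrite exprVn; ring.
have p1 : primitive (bump0 e) (fun t => e * (- 2 * (e * t) * (oneDsqr (e * t))^-1 ^+ 2)).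
  apply: derive_primitive => [x|].
    exact: (is_derive_scale e x dV).
  have ce : continuous (fun t : R => e * t).
    by move=> x; apply: cvgM; [exact: cvg_cst|exact: cvg_id].
  have cb : continuous (fun t => (oneDsqr (e * t))^-1).
    move=> x; apply: (@continuous_comp _ _ _ (fun t => e * t) (fun u => (oneDsqr u)^-1)).
      exact: ce.
    exact: continuous_oneDsqrV.
  move=> x; apply: cvgM; first exact: cvg_cst.
  apply: cvgM; first by apply: cvgM; [exact: cvg_cst|exact: ce].
  by rewrite expr2; apply: cvgM; exact: cb.
by apply: eq_primitive p1 => t; rewrite /bump1 /bump0; ring.
Qed.

Lemma bump1_primitive e : primitive (bump1 e) (bump2 e).
Proof.
have pX : primitive (fun t => e * t) (fun=> e).
  apply: derive_primitive => [x|]; last exact: cst_continuous.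
  by have := is_deriveZ e (is_derive_id x 1); rewrite /GRing.scale/= mulr1.
have pb := bump0_primitive e.
have h := primitiveZ (- 2 * e) (primitiveM pX (primitiveM pb pb)).
exact: h.
Qed.

(** Its integral is at most pi / e by means of the arctangent, and its square is smaller since its
    values are at most 1. *)
Lemma bump0_L2 e : 0 < e -> bump0 e \in L2r.
Proof.
move=> e0; have cb := primitive_continuous (bump0_primitive e).
have mb := continuous_measurable_fun cb.
have pA : primitive (fun t => e^-1 * atan (e * t)) (bump0 e).
  have : primitive (fun t => e^-1 * atan (e * t)) (fun t => e^-1 * (e * bump0 e t)).
    apply: primitiveZ; apply: derive_primitive => [x|].
      by apply: is_derive_scale => t; exact: is_derive1_atan.
    by move=> x; apply: cvgM; [exact: cvg_cst|exact: cb].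
  by apply: eq_primitive => t; rewrite mulrA mulVf ?mul1r// gt_eqF.
have [ib Eb] := pA.
have le : (\int[mu]_t (bump0 e t)%:E <= (e^-1 * pi)%:E)%E.
  apply: ge0_integral_le_bounded => // [t|n]; first exact: ltW (bump0_gt0 _ _).
  have -> : (\int[mu]_(t in `[(- n%:R)%R, n%:R%R]) (bump0 e t)%:E =
    (\int[mu]_(t in `[(- n%:R)%R, n%:R%R]) bump0 e t)%R%:E)%E.
    by rewrite fineK//; exact: integrable_fin_num (ib _ _).
  rewrite lee_fin -Eb; last first.
    by have : 0 <= n%:R :> R by []; lra.
  rewrite -mulrBr ler_pM2l ?invr_gt0//.
  have := atan_ltpi2 (e * n%:R); have := atan_gtNpi2 (e * - n%:R); lra.
have ib' : mu.-integrable setT (EFin \o bump0 e).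
  apply/integrableP; split; first exact/measurable_EFinP.
  under eq_integral => t _ do rewrite /= ger0_norm ?(ltW (bump0_gt0 e t))//.
  by apply: (le_lt_trans le); rewrite ltry.
apply: sqr_integrable_Lfun2 => //; apply: le_integrable ib' => //.
  by apply/measurable_EFinP/measurable_funX.
move=> t _ /=; rewrite lee_fin; have h := bump0_gt0 e t; have E := bump0_eq e t.
rewrite normrX (gtr0_norm h) expr2 ler_piMr ?(ltW h)//.
have : 0 <= bump0 e t * (e * t) ^+ 2 by rewrite mulr_ge0 ?sqr_ge0// ltW.
nra.
Qed.

Definition cis (l t : R) : C := cos (l * t) +i* sin (l * t).

Lemma H1_strong_modulate (l : R) (p p' : R -> R) : p \in L2r -> p' \in L2r ->
  primitive p p' ->
  H1_strong (fun t => (p t)%:C * cis l t)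
    (fun t => (p' t)%:C * cis l t + (0 +i* l) * ((p t)%:C * cis l t)).
Proof.
move=> lp lp' pp.
have pc := primitive_cos l; have ps := primitive_sin l.
have lm q : q \in L2r -> L2_complex (fun t => (q t)%:C * cis l t).
  move=> lq; split.
    rewrite (_ : (fun _ => _) = fun t => cos (l * t) * q t); last first.
      by apply/funext => t; rewrite ReM/=; ring.
    apply: Lfun2M lq; first exact: primitive_continuous pc.
    by move=> t; exact: norm_cos_le1.
  rewrite (_ : (fun _ => _) = fun t => sin (l * t) * q t); last first.
    by apply/funext => t; rewrite ImM/=; ring.
  apply: Lfun2M lq; first exact: primitive_continuous ps.
  by move=> t; exact: norm_sin_le1.
split.
- exact: lm.
- by apply: L2_complexD; [exact: lm|exact: L2_complexZ (lm _ lp)].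
- rewrite (_ : (fun _ => _) = fun t => p t * cos (l * t)); last first.
    by apply/funext => t; rewrite ReM/=; ring.
  by apply: eq_primitive (primitiveM pp pc) => t; rewrite ReD !ReM !ImM/=; ring.
- rewrite (_ : (fun _ => _) = fun t => p t * sin (l * t)); last first.
    by apply/funext => t; rewrite ImM/=; ring.
  by apply: eq_primitive (primitiveM pp ps) => t; rewrite ImD !ImM !ReM/=; ring.
Qed.

(** Since [cis] is unimodular, the difference of the two sides is |x A - y B|^2. *)
Lemma sqnorm_comb (x y : R) (l t : R) (A B : 'cV[C]_2) :
  sqnorm ((x%:C * cis l t) *: A + (y%:C * cis l t) *: B) <=
  2 * (x ^+ 2 * sqnorm A + y ^+ 2 * sqnorm B).
Proof.
have H (u v : C) : dotC ((x%:C * cis l t) * u + (y%:C * cis l t) * v)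
   ((x%:C * cis l t) * u + (y%:C * cis l t) * v) <=
   2 * (x ^+ 2 * dotC u u + y ^+ 2 * dotC v v).
  rewrite -subr_ge0.
  have cs := cos2Dsin2 (l * t); set co := cos (l * t) in cs *; set si := sin (l * t) in cs *.
  have -> : 2 * (x ^+ 2 * dotC u u + y ^+ 2 * dotC v v) -
    dotC ((x%:C * cis l t) * u + (y%:C * cis l t) * v)
         ((x%:C * cis l t) * u + (y%:C * cis l t) * v) =
    (x * complex.Re u - y * complex.Re v) ^+ 2 + (x * complex.Im u - y * complex.Im v) ^+ 2.
    have cs' : si ^+ 2 = 1 - co ^+ 2 by rewrite -cs; ring.
    rewrite /dotC /cis -/co -/si; case: u v => [u1 u2] [v1 v2] /=; ring: cs'.
  by rewrite addr_ge0 ?sqr_ge0.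
rewrite /sqnorm !mxE; have := H (A 0 0) (B 0 0); have := H (A 1 0) (B 1 0); lra.
Qed.

Lemma sqnorm_scale (x : R) (l t : R) (A : 'cV[C]_2) :
  sqnorm ((x%:C * cis l t) *: A) = x ^+ 2 * sqnorm A.
Proof.
have cs : sin (l * t) ^+ 2 = 1 - cos (l * t) ^+ 2 by rewrite -(cos2Dsin2 (l * t)); ring.
rewrite /sqnorm /dotC !mxE /cis.
case: (A 0 0) (A 1 0) => [u1 u2] [v1 v2] /=; ring: cs.
Qed.

(* Test on e^(i l y) v / (1 + (e y)^2): since 1 / (1 + y^2) dominates its first
   two derivatives up to constants, S(d/dy) Z is pointwise O(e) |Z|. *)
Lemma operator_not_invertible (S : 'M[{poly C}]_2) (l : R) :
  (forall i j, size (S i j) <= 3)%N -> root (\det S) (0 +i* l) ->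
  ~ operator_invertible S.
Proof.
move=> sS /eval_kernel[v v0 Ev] [_ _ [M HM]].
rewrite eval_deg2// in Ev; set r := 0 +i* l in Ev.
(* The Leibniz rule for S(D) (p e^(r t) v): p multiplies S(r) v = 0, p' multiplies A = S'(r) v, and
   p'' multiplies B = S''(r) v / 2. *)
pose A := map_mx (coefp 1) S *m v + map_mx (coefp 2) S *m ((2 * r) *: v).
pose B := map_mx (coefp 2) S *m v.
have sv : 0 < sqnorm v.
  rewrite lt_neqAle sqnorm_ge0 andbT; apply/negP => /eqP/esym/sqnorm_eq0 h.
  by rewrite h eqxx in v0.
(* Pointwise |g|^2 <= K e^2 |Z|^2; the 64 is the square of the constant in [bump2_le]. Using K <= (K
   + 1)^2 avoids a square root. *)
pose K := 2 * (sqnorm A + 64 * sqnorm B) / sqnorm v.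
have K0 : 0 <= K.
  have := sqnorm_ge0 A; have := sqnorm_ge0 B => ? ?.
  by rewrite divr_ge0 ?(ltW sv)//; lra.
(* Chosen so that |M| e (K + 1) <= 1 / 2, whence |Z| <= M |g| <= |Z| / 2 in norm. *)
pose e : R := (1 + 2 * `|M| * (K + 1))^-1.
have D0 : 0 <= `|M| * (K + 1) by rewrite mulr_ge0//; lra.
have e0 : 0 < e by rewrite invr_gt0; lra.
have e1 : e <= 1 by rewrite invf_le1; lra.
have eM : `|M| * (e * (K + 1)) <= 1 / 2.
  rewrite mulrCA /e mulrC ler_pdivrMr; lra.
pose p0 t := (bump0 e t)%:C * cis l t.
pose p1 t := (bump1 e t)%:C * cis l t.
pose p2 t := (bump2 e t)%:C * cis l t.
have lb0 := bump0_L2 e0.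
have lb1 : bump1 e \in L2r.
  apply: (Lfun2_le (M := e) _ lb0) => [|t]; last exact: bump1_le (ltW e0).
  exact: continuous_measurable_fun (primitive_continuous (bump1_primitive e)).
have mb2 : measurable_fun setT (bump2 e).
  have m0 := continuous_measurable_fun (primitive_continuous (bump0_primitive e)).
  have m1 := continuous_measurable_fun (primitive_continuous (bump1_primitive e)).
  apply: measurable_funM => //; apply: measurable_funD.
    by apply: measurable_funM => //; exact: measurable_funM.
  apply: measurable_funM; first exact: measurable_funM.
  by apply: measurable_funD; exact: measurable_funM.
have lb2 : bump2 e \in L2r.
  by apply: (Lfun2_le (M := 8 * e ^+ 2) mb2 lb0) => t; exact: bump2_le (ltW e0).
have H0 : H1_strong p0 (fun t => p1 t + r * p0 t).
  exact: H1_strong_modulate lb0 lb1 (bump0_primitive e).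
have H1 : H1_strong p1 (fun t => p2 t + r * p1 t).
  exact: H1_strong_modulate lb1 lb2 (bump1_primitive e).
pose Z t := p0 t *: v; pose Z1 t := (p1 t + r * p0 t) *: v.
pose Z2 t := ((p2 t + r * p1 t) + r * (p1 t + r * p0 t)) *: v.
pose g t := p1 t *: A + p2 t *: B.
have HZ : H1_derivative Z Z1.
  move=> i; apply: H1_strong_derivative.
  rewrite (_ : (fun _ => _) = fun t => v i 0 * p0 t); last first.
    by apply/funext => t; rewrite mxE mulrC.
  rewrite (_ : (fun y => Z1 y i 0) = fun t => v i 0 * (p1 t + r * p0 t)); last first.
    by apply/funext => t; rewrite mxE mulrC.
  exact: H1_strongZ.
have HZ1 : H1_derivative Z1 Z2.
  move=> i; apply: H1_strong_derivative.
  rewrite (_ : (fun _ => _) = fun t => v i 0 * (p1 t + r * p0 t)); last first.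
    by apply/funext => t; rewrite mxE mulrC.
  rewrite (_ : (fun y => Z2 y i 0) = fun t => v i 0 * ((p2 t + r * p1 t) + r * (p1 t + r * p0 t))); last first.
    by apply/funext => t; rewrite mxE mulrC.
  by apply: H1_strongZ; apply: H1_strongD => //; exact: H1_strongZ.
have Hg : operator_graph S Z g.
  exists Z1, Z2; split => //; apply: aeW => t.
  have -> : g t = g t + p0 t *: (map_mx (coefp 0) S *m v +
     map_mx (coefp 1) S *m (r *: v) + map_mx (coefp 2) S *m (r ^+ 2 *: v)).
    by rewrite Ev scaler0 addr0.
  rewrite /g /A /B /Z /Z1 /Z2 -!scalemxAr.
  move: (map_mx (coefp 0) S *m v) (map_mx (coefp 1) S *m v) (map_mx (coefp 2) S *m v).
  by move=> X0 X1 X2; apply/colP => i; rewrite !mxE; ring.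
have lZ : L2 Z by move=> i; have [] := HZ i.
have lg : L2 g.
  have [l1 _ _ _] := H1; have [_ l2 _ _] := H1.
  have lp2 : L2_complex p2.
    have := L2_complexD l2 (L2_complexZ (- r) l1).
    rewrite (_ : (fun _ => _) = p2)//; apply/funext => t; ring.
  move=> i; rewrite (_ : (fun _ => _) = fun t => A i 0 * p1 t + B i 0 * p2 t); last first.
    by apply/funext => t; rewrite !mxE mulrC [p2 t * _]mulrC.
  by apply: L2_complexD; exact: L2_complexZ.
have pw t : sqnorm (g t) <= (e * (K + 1)) ^+ 2 * sqnorm (Z t).
  rewrite sqnorm_scale; apply: (le_trans (sqnorm_comb _ _ _ _ _ _)).
  have b1 := bump1_le t (ltW e0); have b2 := bump2_le t (ltW e0).
  have sq (x y : R) : `|x| <= y -> x ^+ 2 <= y ^+ 2.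
    move=> xy; rewrite -(real_normK (num_real x)) ler_pXn2r ?nnegrE//.
    exact: le_trans xy.
  have {}b1 := sq _ _ b1; have {}b2 := sq _ _ b2.
  rewrite [leRHS]exprMn real_normK ?num_real// in b1.
  rewrite [leRHS]exprMn [X in X * _]exprMn real_normK ?num_real// in b2.
  set p := bump0 e t ^+ 2 in b1 b2 *.
  have p_0 : 0 <= p by exact: sqr_ge0.
  have b3 : bump2 e t ^+ 2 <= 64 * (e ^+ 2 * p).
    apply: (le_trans b2); rewrite (_ : 8 ^+ 2 * _ * p = 64 * (e ^+ 2 * p) * e ^+ 2); last by ring.
    apply: ler_piMr; first by have := mulr_ge0 (sqr_ge0 e) p_0; lra.
    by apply: exprn_ile1; first exact: ltW.
  have KE : K * sqnorm v = 2 * (sqnorm A + 64 * sqnorm B).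
    by rewrite /K divfK// gt_eqF.
  have c1 := ler_wpM2r (sqnorm_ge0 A) b1; have c2 := ler_wpM2r (sqnorm_ge0 B) b3.
  apply: (@le_trans _ _ (e ^+ 2 * p * (K * sqnorm v))); first by rewrite KE; lra.
  rewrite (_ : (e * (K + 1)) ^+ 2 * (p * sqnorm v) =
     e ^+ 2 * p * ((K + 1) ^+ 2 * sqnorm v)); last by ring.
  apply: ler_wpM2l; first by rewrite mulr_ge0 ?sqr_ge0.
  apply: ler_wpM2r; first exact: ltW.
  nra.
have iZ := sqnorm_integrable lZ; have ig := sqnorm_integrable lg.
have le1 : (L2_norm g <= (e * (K + 1))%:E * L2_norm Z)%E.
  apply: L2_norm_le; first by rewrite mulr_ge0 ?addr_ge0// ltW.
  rewrite -ge0_integralZl//; last 3 first.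
  - exact: measurable_int iZ.
  - by move=> t _; rewrite lee_fin sqnorm_ge0.
  - by rewrite lee_fin sqr_ge0.
  apply: ge0_le_integral => //.
  - by move=> t _; rewrite lee_fin sqnorm_ge0.
  - exact: measurable_int ig.
  - exact: measurable_funeM (measurable_int _ iZ).
  - by move=> t _; rewrite -EFinM lee_fin pw.
have fin (X : R -> 'cV[C]_2) : L2 X -> L2_norm X \is a fin_num.
  move=> lX; rewrite ge0_fin_numE ?Lnorm_ge0// L2_normE poweR_lty//.
  exact: (integrable_lty _ (sqnorm_integrable lX)).
have le2 := HM Z g lg Hg.
have nZ : L2_norm Z = 0%E.
  have := fin _ lZ; have := fin _ lg; move: le1 le2.
  have : (0 <= L2_norm Z)%E by exact: Lnorm_ge0.
  have : (0 <= L2_norm g)%E by exact: Lnorm_ge0.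
  case: (L2_norm Z) => [n||]//; case: (L2_norm g) => [m||]//.
  rewrite -!EFinM !lee_fin => m0 n0 le1 le2 _ _; congr EFin.
  have h1 : M * m <= `|M| * (e * (K + 1) * n).
    apply: (@le_trans _ _ (`|M| * m)); first by rewrite ler_wpM2r// ler_norm.
    exact: ler_wpM2l.
  have := ler_wpM2r n0 eM; lra.
(* [Z] vanishes nowhere, so the whole line would be a null set. *)
have [N [mN N0 sub]] := L2_norm_eq0 lZ nZ.
have NT : N = setT.
  apply/seteqP; split => // t _; apply: sub => /= Z0.
  have := sqnorm_scale (bump0 e t) l t v; rewrite -/(p0 t) -/(Z t) Z0.
  rewrite {1}/sqnorm /dotC !mxE/= !mulr0 !addr0 => /esym/eqP.
  by rewrite mulf_eq0 sqrf_eq0 !gt_eqF// bump0_gt0.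
have : mu setT = 0%E by rewrite -NT.
by rewrite -set_itvNyy lebesgue_measure_itv.
Qed.

End WeylSequence.

(** * The dispersion relation *)

Section Quartic.
Context {R : realType}.
Local Notation C := R[i].

Lemma dotC_mul (x y : C) : dotC (x * y) (x * y) = dotC x x * dotC y y.
Proof. by case: x y => [x1 x2] [y1 y2]; rewrite /dotC/=; ring. Qed.

Lemma dotC_prod_ge (T : R) (s : seq C) (F : C -> C) : 0 <= T ->
  (forall z, z \in s -> T <= dotC (F z) (F z)) ->
  T ^+ size s <= dotC (\prod_(z <- s) F z) (\prod_(z <- s) F z).
Proof.
move=> T0; elim: s => [|z s IH] H.
  by rewrite big_nil /dotC/= mulr0 addr0 mulr1 expr0.
rewrite big_cons dotC_mul exprS; apply: ler_pM => //; first exact: exprn_ge0.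
  by apply: H; rewrite mem_head.
by apply: IH => y ys; apply: H; rewrite inE ys orbT.
Qed.

Definition quartic (e A B D : R) : {poly C} :=
  e%:C *: ('X^2 - 1%:P) ^+ 2 - (A%:C *: 'X^2 + B%:C *: 'X + (D%:C)%:P).

Lemma quartic_horner e A B D (z : C) : (quartic e A B D).[z] =
  e%:C * (z ^+ 2 - 1) ^+ 2 - (A%:C * z ^+ 2 + B%:C * z + D%:C).
Proof. by rewrite /quartic !hornerE. Qed.

(* For small e all the real roots are far from the roots of A x^2 + B x + D,
   whereas the product of the distances from one of these to all the roots of
   the quartic does not depend on e. *)
Lemma quartic_nonreal_root (A B D : R) : 0 < A -> B ^+ 2 < 4 * A * D ->
  exists e z, [/\ 0 < e, root (quartic e A B D) z & complex.Im z != 0].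
Proof.
move=> A0 disc.
(* [z0] is a root of the quadratic, so the quartic takes the value e (z0^2 - 1)^2 there, and the
   product of the z0 - z over its roots z is (z0^2 - 1)^2. *)
pose d := Num.sqrt (4 * A * D - B ^+ 2).
have d2 : d ^+ 2 = 4 * A * D - B ^+ 2 by rewrite sqr_sqrtr// subr_ge0 ltW.
pose x := - B / (2 * A); pose z0 : C := x +i* (d / (2 * A)).
have q0 : A%:C * z0 ^+ 2 + B%:C * z0 + D%:C = 0.
  apply: eqC; rewrite /z0 /x expr2/=; field: d2; by rewrite gt_eqF.
(* The minimum of the quadratic on the real line. *)
pose m := D - B ^+ 2 / (4 * A).
have m0 : 0 < m.
  rewrite /m subr_gt0 ltr_pdivrMr ?mulr_gt0//; lra.
have qm (s : R) : m <= A * s ^+ 2 + B * s + D.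
  rewrite -subr_ge0 (_ : _ - m = A * (s + B / (2 * A)) ^+ 2).
    by rewrite mulr_ge0 ?sqr_ge0// ltW.
  by rewrite /m; field; rewrite gt_eqF.
pose N := dotC (z0 ^+ 2 - 1) (z0 ^+ 2 - 1).
have N0 : 0 <= N by exact: dotC_ge0.
(* Squared distances at least T to all four roots would give T^4 <= N^2. A real s at squared
   distance less than T from [z0] satisfies s^2 <= U. *)
pose T := N + 1; pose U := 2 * x ^+ 2 + 2 * T.
have U0 : 0 <= U by have := sqr_ge0 x; rewrite /U /T; lra.
(* For s^2 <= U this yields e (s^2 - 1)^2 <= m / 2, below the minimum of the quadratic, so such an s
   is not a root of the quartic. *)
pose e := m / (2 * (U + 1) ^+ 2).
have U1 : 0 < (U + 1) ^+ 2 by rewrite exprn_gt0//; lra.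
have e0 : 0 < e by rewrite divr_gt0// mulr_gt0.
exists e.
pose Q2 := A%:C *: 'X^2 + B%:C *: 'X + (D%:C)%:P : {poly C}.
have eC0 : e%:C != 0 :> C by rewrite -(rmorph0 (real_complex R)) (inj_eq (@complexI R)) gt_eqF.
have mon : (('X^2 - 1%:P) ^+ 2 : {poly C}) \is monic.
  by rewrite monic_exp// monicXnsubC.
have s4 : size (e%:C *: (('X^2 - 1%:P) ^+ 2 : {poly C})) = 5.
  by rewrite size_scale// expr2 size_monicM ?monicXnsubC ?monic_neq0 ?monicXnsubC// size_XnsubC.
have sQ2 : (size (- Q2) < 5)%N.
  rewrite size_polyN; apply: (@leq_ltn_trans 3) => //.
  apply/leq_sizeP => -[|[|[|j]]]// _.
  by rewrite /Q2 !coefE/= !mulr0 !addr0.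
have lc : lead_coef (quartic e A B D) = e%:C.
  by rewrite /quartic lead_coefDl ?s4// lead_coefZ (monicP mon) mulr1.
have sz : size (quartic e A B D) = 5 by rewrite /quartic size_polyDl s4.
have [rs Ers] := closed_field_poly_normal (quartic e A B D).
have srs : size rs = 4.
  by move: sz; rewrite Ers lc size_scale// size_prod_XsubC => -[].
have [/hasP[z zrs zIm]|/hasPn real_rs] := boolP (has (fun z => complex.Im z != 0) rs).
  by exists z; split => //; rewrite Ers lc rootZ// root_prod_XsubC.
exfalso.
have far z : z \in rs -> T <= dotC (z0 - z) (z0 - z).
  move=> zrs; have := real_rs _ zrs; rewrite negbK => /eqP zIm.
  have : root (quartic e A B D) z by rewrite Ers lc rootZ// root_prod_XsubC.
  rewrite rootE quartic_horner; case: z zrs zIm => [s si] zrs /= -> /eqP.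
  move=> /(congr1 (@complex.Re R)) /= E.
  have {}E : e * (s ^+ 2 - 1) ^+ 2 = A * s ^+ 2 + B * s + D.
    by move: E; rewrite !expr2/=; lra.
  rewrite leNgt; apply/negP => lt.
  have lt' : (x - s) ^+ 2 < T.
    apply: le_lt_trans lt; rewrite /dotC /z0/= -!expr2 lerDl; exact: sqr_ge0.
  have sU : s ^+ 2 <= U.
    by have := sqr_ge0 (2 * x - s); rewrite /U; move: lt'; lra.
  have h : e * (s ^+ 2 - 1) ^+ 2 <= m / 2.
    apply: (@le_trans _ _ (e * (U + 1) ^+ 2)).
      by rewrite ler_wpM2l ?(ltW e0)//; have := sqr_ge0 s; nra.
    by rewrite /e le_eqVlt; apply/orP; left; apply/eqP; field; rewrite !gt_eqF//; lra.
  by have := qm s; rewrite -E; lra.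
have T1 : 1 <= T by rewrite lerDr.
have := dotC_prod_ge (le_trans ler01 T1) far.
have -> : \prod_(z <- rs) (z0 - z) = (z0 ^+ 2 - 1) ^+ 2.
  apply: (mulfI eC0).
  have := quartic_horner e A B D z0; rewrite q0 subr0 => <-.
  rewrite Ers lc hornerZ horner_prod; congr (_ * _).
  by apply: eq_bigr => z _; rewrite !hornerE.
rewrite srs expr2 dotC_mul -/N => le.
have : N * N < T ^+ 4.
  apply: (@lt_le_trans _ _ (T ^+ 2)); first by rewrite /T; nra.
  by apply: ler_weXn2l.
lra.
Qed.

End Quartic.

(** * Criteria for stability and instability *)

Section SpectralStability.
Context {R : realType}.
Local Notation C := R[i].

(* On D = i l, with lambda = i l (z + c), the determinant is l^2 times the quartic
   with parameters e = l^2, 2 b + 4 w^2, - 8 w k, 4 k^2 - 2 b at z. *)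
Lemma unstable_criterion (f : R -> R) (a k w c : R) :
  let b := a ^+ 2 * derive1 f (a ^+ 2) in
  0 < 2 * b + 4 * w ^+ 2 -> b * (b + 2 * (w ^+ 2 - k ^+ 2)) < 0 ->
  spectrally_unstable f a k w c.
Proof.
move=> b A0 disc.
have [|e [z [e0 rz zIm]]] := @quartic_nonreal_root R (2 * b + 4 * w ^+ 2) (- 8 * w * k)
  (4 * k ^+ 2 - 2 * b) A0; first by lra.
pose l := Num.sqrt e; have l2 : l ^+ 2 = e by rewrite sqr_sqrtr// ltW.
have l0 : l != 0 by rewrite sqrtr_eq0 -ltNge.
pose lam := (0 +i* l) * (z + c%:C).
move=> /(_ lam) /=; rewrite /spectrum/= => H.
(* Its real part is - l Im z. *)
have Re_lam : complex.Re lam != 0.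
  by rewrite /lam ReM/= ImD/= addr0 mul0r sub0r oppr_eq0 mulf_neq0.
move/eqP: Re_lam; apply; apply: H.
apply: (@operator_not_invertible _ _ l); first by move=> i j; exact: size_P_symbol.
move: rz; rewrite !rootE quartic_horner => /eqP rz.
have -> : (\det (P_symbol f a k w c lam)).[0 +i* l] = (l%:C) ^+ 2 *
  (e%:C * (z ^+ 2 - 1) ^+ 2 - ((2 * b + 4 * w ^+ 2)%:C * z ^+ 2 + (- 8 * w * k)%:C * z +
  (4 * k ^+ 2 - 2 * b)%:C)).
  rewrite det_mx2 /P_symbol /J_symbol /H_symbol /mx22 !mxE /= -!polyCN ?mulr1n ?mulr0n.
  rewrite !(hornerD, hornerN, hornerM, hornerXn, hornerX, hornerC, horner0).
  rewrite -l2 (_ : 2 * a ^+ 2 * _ = 2 * b) ?[RHS]mulrA// /lam.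
  have -> : 0 +i* l = 'i%C * l%:C by apply: eqC => /=; ring.
  have i2 : ('i%C : C) ^+ 2 = - 1 by rewrite sqr_i.
  rewrite !(rmorphD, rmorphN, rmorphM, rmorphXn, rmorphB, rmorph_nat) /=.
  ring: i2.
by rewrite rz mulr0.
Qed.

Lemma stable_criterion (f : R -> R) (a k w c s : R) :
  let b := a ^+ 2 * derive1 f (a ^+ 2) in
  0 < 1 - s ^+ 2 -> 0 <= b -> (2 * (k - w * s)) ^+ 2 <= 2 * b * (1 - s ^+ 2) ->
  c != 1 -> c != -1 -> spectrally_stable f a k w c.
Proof.
move=> b m0 b0 kb c1 cN1 l /= nl; apply/eqP/negPn/negP => l0; apply: nl.
exact: (P_symbol_invertible m0 b0 kb c1 cN1 l0).
Qed.

End SpectralStability.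

Theorem proposition10 (R : realType) (f : R -> R) (a k w c : R)
    (hf : C2_nonneg f) (ha : 0 < a)
    (hdisp : w ^+ 2 = k ^+ 2 + f (a ^+ 2))
    (hc1 : c != 1) (hcN1 : c != -1) :
  (0 < f (a ^+ 2) ->
     (0 < derive1 f (a ^+ 2) -> spectrally_stable f a k w c) /\
     (- 2 * f (a ^+ 2) < a ^+ 2 * derive1 f (a ^+ 2) /\
      a ^+ 2 * derive1 f (a ^+ 2) < 0 ->
        spectrally_unstable f a k w c)) /\
  (f (a ^+ 2) < 0 ->
     (- 2 * f (a ^+ 2) < a ^+ 2 * derive1 f (a ^+ 2) ->
        spectrally_stable f a k w c) /\
     (0 < a ^+ 2 * derive1 f (a ^+ 2) /\
      a ^+ 2 * derive1 f (a ^+ 2) < - 2 * f (a ^+ 2) ->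
        spectrally_unstable f a k w c)).
Proof.
have k2 := sqr_ge0 k; have w2 := sqr_ge0 w.
have a2 : 0 < a ^+ 2 by rewrite exprn_gt0.
have -> : f (a ^+ 2) = w ^+ 2 - k ^+ 2 by rewrite hdisp addrC addKr.
split => f0; split.
- move=> f1.
  have w0 : w != 0 by apply/eqP => w0; move: f0; rewrite w0 expr0n/=; lra.
  have w20 : 0 < w ^+ 2 by rewrite exprn_even_gt0.
  (* The choice s = k / w satisfies s^2 < 1 as k^2 < w^2, and cancels the cross term k - w s. *)
  have m0 : 0 < 1 - (k / w) ^+ 2.
    by rewrite (_ : _ - _ = (w ^+ 2 - k ^+ 2) / w ^+ 2) ?divr_gt0//; field.
  apply: (stable_criterion m0) => //.
    by rewrite mulr_ge0 ?ltW.
  rewrite (_ : k - w * (k / w) = 0); last by field.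
  by rewrite mulr0 expr0n/= !mulr_ge0 ?ltW.
(* Here b > -2 (w^2 - k^2) gives 2 b + 4 w^2 > 4 k^2 >= 0. *)
- move=> [h1 h2]; apply: unstable_criterion; first by lra.
  by rewrite nmulr_rlt0//; lra.
- move=> h.
  have k0 : k != 0 by apply/eqP => k0; move: f0; rewrite k0 expr0n/=; lra.
  have k20 : 0 < k ^+ 2 by rewrite exprn_even_gt0.
  (* For s = w / k one has k - w s = k (1 - s^2), and the discriminant condition reduces to 4 (k^2 -
     w^2) <= 2 b, which is the hypothesis up to strictness. *)
  have m0 : 0 < 1 - (w / k) ^+ 2.
    by rewrite (_ : _ - _ = (k ^+ 2 - w ^+ 2) / k ^+ 2) ?divr_gt0 ?subr_gt0//; [lra|field].
  apply: (stable_criterion m0) => //; first by lra.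
  rewrite (_ : (2 * (k - w * (w / k))) ^+ 2 = 4 * (k ^+ 2 - w ^+ 2) * (1 - (w / k) ^+ 2)); last by field.
  by rewrite ler_pM2r//; lra.
- move=> [h1 h2]; apply: unstable_criterion; first by lra.
  by rewrite pmulr_rlt0//; lra.
Qed.
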